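(* Let $\ell\ge2$, let $K$ be a kernel of order $\ell$ with $k_\ell=\int u^\ell K(u)\,du$, and let $X_1,X_2,\dots$ be iid real random variables with Lebesgue density $f\in W^{\ell,1}$. Let $d=d_\infty$ or $d=d_{kuip,k}$ for some $k\in\mathbb{N}$, and let $s(n)=cn^{-\gamma}$ with $c>0$ and $0<\gamma<1/2$. Let $h_{s,n}>0$ be a bandwidth chosen as a solution $h$ of $d(F_n,\hat F_n^h)=s(n)$. Then almost surely, as $n\to\infty$, $$h_{s,n}=\left(\frac{c\,\ell!}{k_\ell\,d(f^{(\ell-1)},0)}\right)^{\frac1\ell}n^{-\frac{\gamma}{\ell}}\,(1+o(1)).$$
   Context: Kernel: for $\ell\in\mathbb{N}$, a function $K:\mathbb{R}\to\mathbb{R}$ (not necessarily nonnegative) is a kernel of order $\ell$ if $u^jK(u)\in L_1(\mathbb{R})$ for $j=0,\dots,\ell$, $\int K(u)\,du=1$, $\int u^jK(u)\,du=0$ for $j=1,\dots,\ell-1$, and $\int u^\ell K(u)\,du=k_\ell\in\mathbb{R}\setminus\{0\}$. $\mathbb{K}(x):=\int_{-\infty}^xK(u)\,du$. Sobolev space: $W^{\ell,1}:=\{f:f,f^{(1)},\dots,f^{(\ell)}\in L_1(\mathbb{R})\}$. Estimators: $F_n$ is the empirical distribution function of $X_1,\dots,X_n$, and for $h>0$, $\hat F_n^h(x):=\frac1n\sum_{i=1}^n\mathbb{K}\left(\frac{x-X_i}{h}\right)$. Distances (the same formulas are used for distribution functions, possibly of signed measures, and for the pair $F=f^{(\ell-1)}$,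 $G=0$): $d_\infty(F,G):=\sup_{x\in\mathbb{R}}|F(x)-G(x)|$; for $k\in\mathbb{N}$, $$d_{kuip,k}(F,G):=\sup_{a_1\le b_1\le a_2\le b_2\le\dots\le a_k\le b_k}\sum_{i=1}^k|(F(b_i)-F(a_i))-(G(b_i)-G(a_i))|.$$ Chosen bandwidth: for this $s(n)$ the equation $d(F_n,\hat F_n^h)=s(n)$ almost surely has at least one solution $h>0$ for all sufficiently large $n$; it need not be unique, and the result does not depend on which solution is taken as $h_{s,n}$.
   Formalization: The constant uses |k_ℓ| in place of k_ℓ: kernels of order ℓ may have k_ℓ<0 (e.g. K(u)=(3-u²)φ(u)/2, ℓ=4, k_4=-3), where the printed root is undefined or negative although h_{s,n}>0; for k_ℓ>0 the formula is unchanged. *)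

(* Defs.v *)
From HB Require Import structures.
From mathcomp Require Import all_boot all_order all_algebra finmap.
From mathcomp Require Import all_classical all_reals all_analysis.

Set Implicit Arguments.
Unset Strict Implicit.
Unset Printing Implicit Defensive.

Import Order.TTheory GRing.Theory Num.Theory.
Import numFieldNormedType.Exports.

Local Open Scope classical_set_scope.
Local Open Scope ring_scope.

Section Kernels.
Variable R : realType.
Local Notation mu := (@lebesgue_measure R).

Definition kernel_moment (K : R -> R) (j : nat) : R :=
  \int[mu]_u (u ^+ j * K u).

Definition kernel_of_order (ell : nat) (K : R -> R) : Prop :=
  [/\ forall j, (j <= ell)%N ->
        mu.-integrable setT (fun u => (u ^+ j * K u)%:E),
      \int[mu]_u K u = 1,
      forall j, (1 <= j < ell)%N -> kernel_moment K j = 0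
    & kernel_moment K ell != 0].

Definition kernel_cdf (K : R -> R) (x : R) : R :=
  \int[mu]_(u in `]-oo, x]) K u.

End Kernels.

Section Sobolev.
Variable R : realType.
Local Notation mu := (@lebesgue_measure R).

Definition test_function (phi : R -> R) : Prop :=
  (forall n x, derivable (derive1n n phi) x 1) /\
  compact (closure [set x | phi x != 0]).

Definition weak_derivative (j : nat) (f g : R -> R) : Prop :=
  locally_integrable setT g /\
  forall phi, test_function phi ->
    \int[mu]_x (f x * derive1n j phi x) = (- 1) ^+ j * \int[mu]_x (g x * phi x).

(* W^{ell,1}, as a property of a representative [f] of its a.e. class. *)
Definition sobolev1 (ell : nat) (f : R -> R) : Prop :=
  mu.-integrable setT (EFin \o f) /\
  forall j, (1 <= j <= ell)%N ->
    exists2 g, weak_derivative j f g & mu.-integrable setT (EFin \o g).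

(* Suprema of f^(j) over points only make sense for a definite version of the
   weak derivative: the continuous one. It is unique when it exists, and it
   exists for [f] in W^{ell,1} and j < ell. *)
Definition continuous_weak_derivative (j : nat) (f : R -> R) : R -> R :=
  xget (fun=> 0) [set g | continuous g /\ weak_derivative j f g].

End Sobolev.

Section Distances.
Variable R : realType.

Definition dist_sup (F G : R -> R) : \bar R :=
  ereal_sup [set (`|F x - G x|)%:E | x in setT].

(* The points a_1 <= b_1 <= ... <= a_k <= b_k are a 0, b 0, ..., a (k-1),
   b (k-1); later values of the sequences are irrelevant. *)
Definition kuiper_points (k : nat) (a b : nat -> R) : Prop :=
  (forall i, (i < k)%N -> a i <= b i) /\
  (forall i, (i.+1 < k)%N -> b i <= a i.+1).

Definition dist_kuiper (k : nat) (F G : R -> R) : \bar R :=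
  ereal_sup [set (\sum_(i < k)
                    `|(F (ab.2 i) - F (ab.1 i)) - (G (ab.2 i) - G (ab.1 i))|)%:E
            | ab in [set ab : (nat -> R) * (nat -> R)
                    | kuiper_points k ab.1 ab.2]].

End Distances.

Section Sampling.
Context (d : measure_display) (T : measurableType d) (R : realType).
Variable P : probability T R.
Local Notation mu := (@lebesgue_measure R).

Definition mutually_independent (X : nat -> {RV P >-> R}) : Prop :=
  forall (J : {fset nat}) (B : nat -> set R), (forall i, measurable (B i)) ->
    P (\bigcap_(i in [set` J]) X i @^-1` B i)
    = (\prod_(i <- J) P (X i @^-1` B i))%E.

Definition has_density (X : {RV P >-> R}) (f : R -> R) : Prop :=
  [/\ measurable_fun setT f,
      forall x, 0 <= f x
    & forall A, measurable A ->
        distribution P X A = (\int[mu]_(x in A) (f x)%:E)%E].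

End Sampling.

Section Estimators.
Variable R : realType.

(* The observations X_1, X_2, ... are x 0, x 1, ... *)
Definition empirical_cdf (x : nat -> R) (n : nat) (t : R) : R :=
  n%:R^-1 * \sum_(i < n) (x i <= t)%R%:R.

Definition smoothed_cdf (K : R -> R) (x : nat -> R) (n : nat) (h t : R) : R :=
  n%:R^-1 * \sum_(i < n) kernel_cdf K ((t - x i) / h).

End Estimators.

(* Main.v *)
(** The smoothed distribution function is the convolution of [F_n] with the
    rescaled kernel, so the error [F_n - \hat F_n^h] differs from
    [D_h = F - F * K_h] by at most a constant times [sup |F_n - F|], uniformly
    in [h].  By Hoeffding's inequality on a grid of quantiles and
    Borel-Cantelli, this supremum is almost surely [o(n^-gamma)], because
    [gamma < 1/2].  Hence [d(D_{h_n}, 0) = c n^-gamma (1 + o(1))].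

    Sobolev regularity makes [F] of class [C^ell] with
    [g = F^(ell) = f^(ell-1)] bounded and uniformly continuous, and Taylor's
    formula gives [D_h = - (-h)^ell k_ell / ell! g + o(h^ell)] uniformly as
    [h -> 0].  So [d(D_h, 0) ~ h^ell |k_ell| / ell! d(g, 0)], which yields the
    asymptotics of [h_n] once [h_n -> 0] is known.

    For the latter, [sup |D_h|] has to be bounded away from [0] on [h >= delta].
    No Fourier analysis is needed: with [h = r t],
    [int f(y) D_t(a - y / r) dy = int f(z) D_h(r (a - z)) dz], the right-hand
    side is at most [sup |D_h|], and for [t] small and [r] large the left-hand
    side is close to [- (-t)^ell k_ell / ell! g(a)], which is nonzero for
    suitable [a]: otherwise [F] would be a polynomial vanishing at [-oo]. *)
Require Import Defs.
From HB Require Import structures.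
From mathcomp Require Import all_boot all_order all_algebra finmap.
From mathcomp Require Import all_classical all_reals all_analysis.
From mathcomp Require Import measurable_realfun ring lra.

Set Implicit Arguments.
Unset Strict Implicit.
Unset Printing Implicit Defensive.

Import Order.TTheory GRing.Theory Num.Theory.
Import numFieldNormedType.Exports.

Local Open Scope classical_set_scope.
Local Open Scope ring_scope.

(** * Integrable functions on the line *)

(** The derivatives of [f] exist only weakly and [f] is one representative of its class, so no
    regularity of [f] at points is available. Everything regular is phrased through antiderivatives:
    if [v j] is any version of the [j]-th weak derivative, then [kernel_cdf (v j)] has the classical
    derivative [kernel_cdf (v j.+1)]. This chain starts at [F] for [j = 0] and ends, for [j = ell],
    at the continuous version of [f^(ell-1)].

    The bandwidth depends on the sample in an arbitrary way. Probability therefore enters only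
    through [sup |F_n - F|], which does not involve [h]; the rest is deterministic and is applied to
    each sample path separately.

    The two kinds of distance are treated together through the properties collected in [sup_like]. A
    Kuiper distance does not see additive constants, so it controls the values of a function only if
    the function vanishes at [-oo]; this is why that property is carried along for [D_h] and [g]. *)

Section Integrals.
Variable R : realType.
Local Notation mu := (@lebesgue_measure R).

Definition L1 (f : R -> R) : Prop := mu.-integrable setT (EFin \o f).

Lemma L1_measurable f : L1 f -> measurable_fun setT f.
Proof. by move=> /integrableP[/measurable_EFinP]. Qed.

Lemma L1_norm f : L1 f -> L1 (fun x => `|f x|).
Proof. exact: integrable_norm. Qed.

Lemma L1_le (g f : R -> R) : measurable_fun setT f ->
  (forall x, `|f x| <= g x) -> L1 g -> L1 f.
Proof.
move=> mf fg; apply: le_integrable => //; first exact/measurable_EFinP.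
move=> x _ /=; rewrite lee_fin (le_trans (fg x))// ler_norm//.
Qed.

Lemma L1D f g : L1 f -> L1 g -> L1 (fun x => f x + g x).
Proof. by move=> lf lg; have := integrableD measurableT lf lg. Qed.

Lemma L1Zl (c : R) f : L1 f -> L1 (fun x => c * f x).
Proof. by move=> lf; have := integrableZl measurableT c lf. Qed.

Lemma L1N f : L1 f -> L1 (fun x => - f x).
Proof.
move=> lf; have := L1Zl (-1) lf.
by congr L1; apply/funext => x; rewrite mulN1r.
Qed.

Lemma L1B f g : L1 f -> L1 g -> L1 (fun x => f x - g x).
Proof. by move=> lf lg; apply: L1D lf (L1N lg). Qed.

Lemma L1_sum I (s : seq I) (F : I -> R -> R) :
  (forall i, L1 (F i)) -> L1 (fun x => \sum_(i <- s) F i x).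
Proof.
move=> lF; elim: s => [|i s IHs].
  rewrite (_ : (fun _ => _) = cst 0); last by apply/funext => x; rewrite big_nil.
  exact: integrable0.
rewrite (_ : (fun _ => _) = fun x => F i x + \sum_(i <- s) F i x).
  exact: L1D.
by apply/funext => x; rewrite big_cons.
Qed.

Lemma L1_bddM (C : R) (b f : R -> R) : measurable_fun setT b ->
  (forall x, `|b x| <= C) -> L1 f -> L1 (fun x => b x * f x).
Proof.
move=> mb bC lf; apply: (@L1_le (fun x => C * `|f x|)).
- by apply: measurable_funM => //; exact: L1_measurable.
- by move=> x; rewrite normrM ler_wpM2r.
- exact/L1Zl/L1_norm.
Qed.

Lemma RintD f g : L1 f -> L1 g ->
  \int[mu]_x (f x + g x) = \int[mu]_x f x + \int[mu]_x g x.
Proof. exact: RintegralD. Qed.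

Lemma RintB f g : L1 f -> L1 g ->
  \int[mu]_x (f x - g x) = \int[mu]_x f x - \int[mu]_x g x.
Proof. exact: RintegralB. Qed.

Lemma RintZl c f : L1 f -> \int[mu]_x (c * f x) = c * \int[mu]_x f x.
Proof. exact: RintegralZl. Qed.

Lemma Rint_sum I (s : seq I) (F : I -> R -> R) :
  (forall i, L1 (F i)) ->
  \int[mu]_x (\sum_(i <- s) F i x) = \sum_(i <- s) \int[mu]_x F i x.
Proof.
move=> lF; elim: s => [|i s IHs].
  rewrite big_nil (_ : (fun _ => _) = cst 0) ?Rintegral_cst ?mul0r//.
  by apply/funext => x; rewrite big_nil.
rewrite big_cons -IHs -RintD//; last exact: L1_sum.
by apply: eq_Rintegral => x _; rewrite big_cons.
Qed.

Lemma Rint_EFin f : L1 f ->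
  (\int[mu]_x f x)%:E = (\int[mu]_x (f x)%:E)%E.
Proof. by move=> lf; rewrite fineK//; exact: integrable_fin_num. Qed.

Lemma Rint_le f g : L1 f -> L1 g -> (forall x, f x <= g x) ->
  \int[mu]_x f x <= \int[mu]_x g x.
Proof. by move=> lf lg fg; apply: le_Rintegral. Qed.

Lemma Rint_le_norm f g : L1 f -> L1 g -> (forall x, `|f x| <= g x) ->
  `|\int[mu]_x f x| <= \int[mu]_x g x.
Proof.
move=> lf lg fg; apply: (le_trans (le_normr_Rintegral _ lf)) => //.
by apply: Rint_le => //; exact: L1_norm.
Qed.

Lemma Rint_bddM_le (C : R) (b f : R -> R) : measurable_fun setT b ->
  (forall x, `|b x| <= C) -> L1 f ->
  `|\int[mu]_x (b x * f x)| <= C * \int[mu]_x `|f x|.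
Proof.
move=> mb bC lf; rewrite -RintZl; last exact: L1_norm.
apply: Rint_le_norm => [||x]; first exact: L1_bddM mb bC lf.
- exact/L1Zl/L1_norm.
- by rewrite normrM ler_wpM2r.
Qed.

Lemma Rint_dominated (f_ : nat -> R -> R) (f g : R -> R) :
  (forall n, measurable_fun setT (f_ n)) -> measurable_fun setT f -> L1 g ->
  (forall n x, `|f_ n x| <= g x) -> (forall x, f_ n x @[n --> \oo] --> f x) ->
  \int[mu]_x f_ n x @[n --> \oo] --> \int[mu]_x f x.
Proof.
move=> mf_ mf lg f_g f_f.
have [|||||lf _ cv] := @dominated_convergence _ _ R mu setT measurableT
   (fun n => EFin \o f_ n) (EFin \o f) (EFin \o g).
- by move=> n; apply/measurable_EFinP; exact: mf_.
- exact/measurable_EFinP.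
- by apply: aeW => x _ /=; apply: cvg_EFin; [exact: nearW|exact: f_f].
- exact: lg.
- by apply: aeW => x n _ /=; rewrite lee_fin.
have lf_ n : L1 (f_ n) by apply: L1_le lg.
apply: fine_cvg; rewrite fineK//; exact: integrable_fin_num.
Qed.

(** A bounded coupling [m] covers every interchange below: it is either the indicator of a
    half-plane or a bounded antiderivative evaluated at a combination of both variables. *)
Lemma Rint_Fubini (C : R) (a b : R -> R) (m : R -> R -> R) :
  L1 a -> L1 b -> measurable_fun setT (fun z : R * R => m z.1 z.2) ->
  (forall x y, `|m x y| <= C) ->
  \int[mu]_x (a x * \int[mu]_y (b y * m x y)) =
  \int[mu]_y (b y * \int[mu]_x (a x * m x y)).
Proof.
move=> la lb mm mC.
have mx x : measurable_fun setT (m x).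
  exact: (measurableT_comp mm (measurable_pair1 x)).
have my y : measurable_fun setT (fun x => m x y).
  exact: (measurableT_comp mm (measurable_pair2 y)).
have lbm x : L1 (fun y => b y * m x y).
  have := L1_bddM (mx x) (mC x) lb.
  by congr L1; apply/funext => y; rewrite mulrC.
have lam y : L1 (fun x => a x * m x y).
  have := L1_bddM (my y) (fun x => mC x y) la.
  by congr L1; apply/funext => x; rewrite mulrC.
pose F (z : R * R) := (a z.1 * (b z.2 * m z.1 z.2))%:E.
have mF : measurable_fun setT F.
  apply/measurable_EFinP; apply: measurable_funM.
    apply: measurableT_comp => //; exact: L1_measurable.
  apply: measurable_funM => //.
  apply: measurableT_comp => //; exact: L1_measurable.
have C0 : 0 <= C by apply: le_trans (mC 0 0).
have iF : (mu \x mu)%E.-integrable setT F.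
  apply: (integrable12ltyP mu mu mF).2.
  pose B := \int[mu]_y `|b y|.
  have B0 : 0 <= B by apply: Rintegral_ge0.
  (* Tonelli: the inner integral of the absolute value is at most [|a x| * (C * B)], which is
     integrable in [x]. *)
  apply: (@le_lt_trans _ _ (\int[mu]_x (`|a x| * (C * B))%:E)%E).
    apply: ge0_le_integral => //.
    - by move=> x _; exact: integral_ge0.
    - have maF : measurable_fun setT (abse \o F) by exact: measurableT_comp.
      exact: (measurable_fun_fubini_tonelli_F (m2 := mu) (abse \o F) maF
        (fun=> abse_ge0 _)).
    - apply/measurable_EFinP; apply: measurable_funM => //.
      by apply: measurableT_comp => //; exact: L1_measurable.
    move=> x _.
    apply: (@le_trans _ _ (\int[mu]_y (`|a x| * (C * `|b y|))%:E)%E).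
      apply: ge0_le_integral => //.
      - apply: measurableT_comp => //.
        by apply: (measurableT_comp mF (measurable_pair1 x)).
      - apply/measurable_EFinP; apply: measurable_funM => //.
        apply: measurable_funM => //.
        by apply: measurableT_comp => //; exact: L1_measurable.
      - move=> y _ /=; rewrite lee_fin !normrM ler_wpM2l//.
        by rewrite mulrC ler_wpM2r.
    have lB : L1 (fun y => `|a x| * (C * `|b y|)) by do 2 apply: L1Zl; exact: L1_norm.
    rewrite -[leLHS]fineK; last exact: integrable_fin_num.
    rewrite lee_fin -[fine _]/(\int[mu]_y (`|a x| * (C * `|b y|))).
    by rewrite RintZl ?RintZl//; [exact: L1_norm|exact/L1Zl/L1_norm].
  have la' : L1 (fun x => `|a x| * (C * B)).
    have := L1Zl (C * B) (L1_norm la).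
    by congr L1; apply/funext => x; rewrite mulrC.
  have /integrableP[_] := la'.
  by under eq_integral => x _ do rewrite /= ger0_norm ?mulr_ge0//.
have H := Fubini iF.
have E1 x : (\int[mu]_y F (x, y) = (a x * \int[mu]_y (b y * m x y))%:E)%E.
  have lx := L1Zl (a x) (lbm x).
  by rewrite -(RintZl (a x) (lbm x)) (Rint_EFin lx).
have E2 y : (\int[mu]_x F (x, y) = (b y * \int[mu]_x (a x * m x y))%:E)%E.
  have ly := L1Zl (b y) (lam y).
  rewrite -(RintZl (b y) (lam y)) (Rint_EFin ly).
  by apply: eq_integral => x _; rewrite /F /= mulrCA.
apply: (congr1 fine).
under eq_integral do rewrite -E1.
by rewrite H; apply: eq_integral => y _; rewrite E2.
Qed.

End Integrals.

Lemma measurable_natr d (T : measurableType d) (R : realType) (p : T -> bool) :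
  measurable_fun setT p -> measurable_fun setT (fun x => (p x)%:R : R).
Proof.
move=> mp; rewrite (_ : (fun _ => _) = fun x => if p x then 1 else 0).
  exact: measurable_fun_ifT.
by apply/funext => x; case: (p x).
Qed.

Lemma norm_natr_le1 (R : realType) (b : bool) : `|b%:R : R| <= 1.
Proof. by case: b; rewrite ?normr1 ?normr0. Qed.

(** * Antiderivatives of integrable functions *)

Section Cdf.
Variable R : realType.
Local Notation mu := (@lebesgue_measure R).
Implicit Types (v : R -> R) (x y : R).

(* [kernel_cdf v] is the antiderivative vanishing at -oo of an integrable [v],
   which need not be a kernel. *)
Lemma kernel_cdfE v x :
  kernel_cdf v x = \int[mu]_t ((t <= x)%R%:R * v t).
Proof.
rewrite /kernel_cdf Rintegral_mkcond; apply: eq_Rintegral => t _.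
rewrite patchE mem_setE in_itv /=.
by case: (t <= x); rewrite ?mul1r ?mul0r.
Qed.

Lemma L1_indicM (p : R -> bool) v : measurable_fun setT p -> L1 v ->
  L1 (fun t => (p t)%:R * v t).
Proof.
by move=> mp; apply: L1_bddM (fun x => norm_natr_le1 _ _); exact: measurable_natr.
Qed.

Lemma measurable_le x : measurable_fun setT (fun t : R => t <= x).
Proof. exact: measurable_fun_ler. Qed.

Lemma kernel_cdf_le v x : L1 v -> `|kernel_cdf v x| <= \int[mu]_t `|v t|.
Proof.
move=> lv; rewrite kernel_cdfE -[leRHS]mul1r.
apply: Rint_bddM_le lv; first exact: measurable_natr (measurable_le x).
by move=> t; exact: norm_natr_le1.
Qed.

(** Dominated convergence, as the indicators of [n < |x|] tend to [0] pointwise. Cutting integrals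
    at such an [M] makes up for kernels and densities without compact support. *)
Lemma L1_tail v e : L1 v -> 0 < e ->
  exists2 M, 0 < M & \int[mu]_x ((M < `|x|)%R%:R * `|v x|) <= e.
Proof.
move=> lv e0.
have mp (M : R) : measurable_fun setT (fun x : R => M < `|x|).
  by apply: measurable_fun_ltr => //; exact: measurableT_comp.
have H : \int[mu]_x ((n%:R < `|x|)%R%:R * `|v x|) @[n --> \oo] --> \int[mu]_x (cst 0 x : R).
  apply: (@Rint_dominated _ _ _ (fun x => `|v x|)).
  - by move=> n; apply: L1_measurable; exact: L1_indicM (mp _) (L1_norm lv).
  - exact: measurable_cst.
  - exact: L1_norm.
  - move=> n x; rewrite normrM normr_id ler_piMl//; exact: norm_natr_le1.
  - move=> x; apply: (@cvg_trans _ ((fun=> 0 : R) @ \oo)); last exact: cvg_cst.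
    apply: near_eq_cvg; near=> n.
    rewrite ltNge (_ : `|x| <= n%:R) ?mul0r//.
    by near: n; exact: nbhs_infty_ger.
rewrite Rintegral_cst// mul0r in H.
move/cvgrPdist_le : H => /(_ _ e0)[N _ HN].
(* The successor makes the radius positive. *)
exists N.+1%:R => //.
have := HN N.+1 (leqnSn _); rewrite sub0r normrN; apply: le_trans.
exact: ler_norm.
Unshelve. all: by end_near. Qed.

Lemma kernel_cdf_sub v x y : L1 v -> x <= y ->
  kernel_cdf v y - kernel_cdf v x = \int[mu]_t ((x < t <= y)%R%:R * v t).
Proof.
move=> lv xy; rewrite !kernel_cdfE -RintB.
- apply: eq_Rintegral => t _.
  rewrite -mulrBl; congr (_ * _).
  have [tx|xt] /= := leP t x; last by rewrite subr0.
  by rewrite (le_trans tx xy) subrr.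
- exact: L1_indicM (measurable_le y) lv.
- exact: L1_indicM (measurable_le x) lv.
Qed.

(** Absolute continuity of the integral, applied to the interval between the two points. *)
Lemma kernel_cdf_unif_cont v e : L1 v -> 0 < e ->
  exists2 d, 0 < d & forall x y, `|x - y| < d ->
    `|kernel_cdf v x - kernel_cdf v y| <= e.
Proof.
move=> lv e0.
have [d [d0 Hd]] := integral_normr_continuous lv e0.
exists d => //.
suff H x y : x <= y -> `|x - y| < d -> `|kernel_cdf v x - kernel_cdf v y| <= e.
  move=> x y xyd; have [xy|/ltW yx] := leP x y; first exact: H.
  by rewrite distrC; apply: H; rewrite // distrC.
move=> xy xyd; rewrite distrC kernel_cdf_sub//.
have mp : measurable_fun setT (fun t : R => x < t <= y).
  by apply: measurable_and; [exact: measurable_fun_ltr|exact: measurable_fun_ler].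
apply: (@le_trans _ _ (\int[mu]_t ((x < t <= y)%R%:R * `|v t|))).
  apply: Rint_le_norm => [||t]; [exact: L1_indicM|exact: L1_indicM (L1_norm lv)|].
  by rewrite normrM ger0_norm.
apply/ltW; rewrite (_ : \int[mu]_t _ = \int[mu]_(t in `]x, y]) `|v t|).
  have muxy : (mu `]x, y] < d%:E)%E; last exact: Hd.
  rewrite lebesgue_measure_itv /= lte_fin; case: ifPn => _; last by rewrite lte_fin.
  by rewrite -EFinB lte_fin (le_lt_trans (ler_norm _))// distrC.
rewrite [RHS]Rintegral_mkcond; apply: eq_Rintegral => t _.
rewrite patchE mem_setE in_itv /=.
by case: ifP; rewrite ?mul1r ?mul0r.
Qed.

Lemma kernel_cdf_continuous v : L1 v -> continuous (kernel_cdf v).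
Proof.
move=> lv x; apply/cvgrPdist_le => e e0.
have [d d0 Hd] := kernel_cdf_unif_cont lv e0.
near=> y; apply: Hd.
by near: y; apply: cvgr_dist_lt.
Unshelve. all: by end_near. Qed.

Lemma kernel_cdf_Noo v e : L1 v -> 0 < e ->
  exists2 M, 0 < M & forall x, x < - M -> `|kernel_cdf v x| <= e.
Proof.
move=> lv e0; have [M M0 HM] := L1_tail lv e0; exists M => // x xM.
apply: le_trans HM; rewrite kernel_cdfE; apply: Rint_le_norm => [||t].
- exact: L1_indicM (measurable_le x) lv.
- apply: L1_indicM (L1_norm lv).
  by apply: measurable_fun_ltr => //; exact: measurableT_comp.
- rewrite normrM ler_wpM2r//; have [tx|] /= := leP t x; last by rewrite normr0.
  have Mt : M < `|t| by rewrite ltr0_norm; lra.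
  by rewrite Mt normr1.
Qed.

Lemma kernel_cdf_oo v e : L1 v -> 0 < e ->
  exists2 M, 0 < M & forall x, M < x -> `|\int[mu]_t v t - kernel_cdf v x| <= e.
Proof.
move=> lv e0; have [M M0 HM] := L1_tail lv e0; exists M => // x xM.
apply: le_trans HM; rewrite kernel_cdfE -RintB//; last first.
  exact: L1_indicM (measurable_le x) lv.
apply: Rint_le_norm => [||t].
- exact: L1B lv (L1_indicM (measurable_le x) lv).
- apply: L1_indicM (L1_norm lv).
  by apply: measurable_fun_ltr => //; exact: measurableT_comp.
- have [tx|xt] /= := leP t x.
    by rewrite mul1r subrr normr0 mulr_ge0.
  have Mt : M < `|t| by rewrite ger0_norm; lra.
  by rewrite mul0r subr0 Mt mul1r.
Qed.

Lemma kernel_cdf_derive v x : L1 v -> {for x, continuous v} ->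
  is_derive x 1 (kernel_cdf v) (v x).
Proof.
move=> lv cv.
have [] := @continuous_FTC1 R v -oo%O x (x + 1) _ _ _ cv.
- by rewrite ltrDl.
- exact: integrableS lv.
- by rewrite ltNyr.
move=> dG Gx; apply: DeriveDef; first exact: dG.
rewrite -derive1E; exact: Gx.
Qed.

End Cdf.

(** * Smooth functions *)

Section Smooth.
Variable R : realType.
Implicit Types (f g : R -> R) (p : {poly R}).

Definition smooth f : Prop := forall n x, derivable (derive1n n f) x 1.

Lemma derive1_eq f f' : (forall x : R, is_derive x (1 : R) f (f' x)) -> (derive1 f) = f'.
Proof. by move=> ff'; apply/funext => x; rewrite derive1E; apply: derive_val. Qed.

(** By induction all iterated derivatives stay in [S]. Exhibiting a family that is closed under
    differentiation avoids formulas for derivatives of order [n]. *)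
Lemma smooth_coind (S : set (R -> R)) :
  (forall f, S f -> exists2 f', S f' & forall x : R, is_derive x (1 : R) f (f' x)) ->
  forall f, S f -> smooth f.
Proof.
move=> HS f Sf n.
suff : S (derive1n n f) by move=> /HS[f' _ ff'] x; have [] := ff' x.
elim: n => // n /HS[f' Sf' ff'].
by rewrite derive1nS (derive1_eq ff').
Qed.

Lemma smooth_is_derive f (x : R) : smooth f -> is_derive x (1 : R) f ((derive1 f) x).
Proof. by move=> /(_ 0%N x) df; rewrite derive1E; exact: derivableP. Qed.

Lemma derive1Sn n f : derive1n n.+1 f = derive1n n (derive1 f).
Proof. exact: iterSr. Qed.

Lemma smooth_derive1 f : smooth f -> smooth (derive1 f).
Proof. by move=> sf n; rewrite -derive1Sn; exact: sf. Qed.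

Lemma smooth_continuous f : smooth f -> continuous f.
Proof.
move=> sf x; apply: differentiable_continuous; apply/derivable1_diffP.
exact: (sf 0%N x).
Qed.

Lemma smooth_eq f f' : (forall x : R, is_derive x (1 : R) f (f' x)) -> smooth f' -> smooth f.
Proof.
move=> ff' sf' [|n] x; first by have [] := ff' x.
by rewrite derive1Sn (derive1_eq ff').
Qed.

(** Differentiability to a finite order, with the derivatives given existentially. The product rule
    turns a product into a sum of products, and only at a finite order can such sums be treated by
    induction. *)
Fixpoint smoothn n f : Prop :=
  if n is m.+1 then
    exists2 f', smoothn m f' & forall x : R, is_derive x (1 : R) f (f' x)
  else True.

Lemma smoothn_smooth f : (forall n, smoothn n f) -> smooth f.
Proof.
move=> + n; move: f; elim: n => [|n IHn] f sf.
  by move=> x; have [f' _ /(_ x)[]] := sf 1%N.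
move=> x; rewrite derive1Sn; apply: IHn => n'.
by have [f' sf' /derive1_eq ->] := sf n'.+1.
Qed.

Lemma is_derive_add f g (x df dg : R) :
  is_derive x (1 : R) f df -> is_derive x (1 : R) g dg ->
  is_derive x (1 : R) (fun x => f x + g x) (df + dg).
Proof. by move=> fdf gdg; exact: is_deriveD. Qed.

Lemma is_derive_sub f g (x df dg : R) :
  is_derive x (1 : R) f df -> is_derive x (1 : R) g dg ->
  is_derive x (1 : R) (fun x => f x - g x) (df - dg).
Proof. by move=> fdf gdg; exact: is_deriveB. Qed.

Lemma is_derive_mul f g (x df dg : R) :
  is_derive x (1 : R) f df -> is_derive x (1 : R) g dg ->
  is_derive x (1 : R) (fun x => f x * g x) (f x * dg + g x * df).
Proof. by move=> fdf gdg; exact: is_deriveM. Qed.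

Lemma is_derive_scale f (c x df : R) : is_derive x (1 : R) f df ->
  is_derive x (1 : R) (fun x => c * f x) (c * df).
Proof. by move=> fdf; exact: is_deriveZ. Qed.

Lemma smoothnD f g n : smoothn n f -> smoothn n g ->
  smoothn n (fun x => f x + g x).
Proof.
elim: n f g => // n IHn f g [f' sf' ff'] [g' sg' gg'].
by exists (fun x => f' x + g' x) => [|x]; [exact: IHn|exact: is_derive_add].
Qed.

Lemma smoothM f g : smooth f -> smooth g -> smooth (fun x => f x * g x).
Proof.
move=> sf sg; apply: smoothn_smooth => n.
elim: n f g sf sg => // n IHn f g sf sg.
exists (fun x => f x * (derive1 g) x + g x * (derive1 f) x).
  apply: smoothnD.
    by apply: IHn sf _; exact: smooth_derive1 sg.
  by apply: IHn sg _; exact: smooth_derive1 sf.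
by move=> x; apply: is_derive_mul; exact: smooth_is_derive.
Qed.

Lemma is_derive_affine f (a b x df : R) : is_derive (a * x + b) (1 : R) f df ->
  is_derive x (1 : R) (fun x => f (a * x + b)) (a * df).
Proof.
move=> fdf; rewrite mulrC.
apply: (@is_derive1_comp _ f (fun x => a * x + b)) => //.
have : is_derive x (1 : R) (fun x => a * x + b) (a * 1 + 0).
  exact: is_derive_add (is_derive_scale _ (is_derive_id _ _)) (is_derive_cst _ _ _).
by rewrite addr0 mulr1.
Qed.

Lemma smooth_affine f (a b : R) : smooth f -> smooth (fun x => f (a * x + b)).
Proof.
move=> sf.
(* The chain rule brings out a factor [a], so the family has to contain scalar multiples. *)
apply: (@smooth_coind
  [set h | exists2 u, smooth u & exists c, h = fun x => c * u (a * x + b)]).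
  move=> _ [u su [c ->]].
  exists (fun x => (c * a) * (derive1 u) (a * x + b)).
    exists (derive1 u); first exact: smooth_derive1.
    by exists (c * a).
  move=> x; rewrite -mulrA; apply: is_derive_scale.
  exact/is_derive_affine/smooth_is_derive.
exists f => //; exists 1; by apply/funext => x; rewrite mul1r.
Qed.

Lemma smoothB f g : smooth f -> smooth g -> smooth (fun x => f x - g x).
Proof.
move=> sf sg; apply: smoothn_smooth => n.
elim: n f g sf sg => // n IHn f g sf sg.
exists (fun x => (derive1 f) x - (derive1 g) x).
  exact: IHn (smooth_derive1 sf) (smooth_derive1 sg).
by move=> x; apply: is_derive_sub; exact: smooth_is_derive.
Qed.

(* The factor [p(1/x)] makes the family closed under differentiation; the
   bump itself is the case [p = 1]. *)
Definition bump_poly p (x : R) : R :=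
  if 0 < x then p.[x^-1] * expR (- x^-1) else 0.

Lemma horner_le p : exists2 c, 0 <= c &
  forall y, 1 <= y -> `|p.[y]| <= c * y ^+ size p.
Proof.
exists (\sum_(i < size p) `|p`_i|); first exact: sumr_ge0.
move=> y y1; rewrite horner_coef mulr_suml (le_trans (ler_norm_sum _ _ _))//.
apply: ler_sum => i _; rewrite normrM ler_wpM2l//.
rewrite normrX ger0_norm; last lra.
by rewrite ler_weXn2l// ltnW.
Qed.

(** With [y = 1 / h >= 1] and [k = size p], the polynomial is at most [c * y ^ k], while
    [exp y >= y ^ (k + 2) / (k + 2)!]. The two spare powers of [y] give [h ^ 2], enough for a zero
    derivative at the origin. *)
Lemma bump_poly_flat p : exists2 c, 0 <= c &
  forall h, 0 < `|h| <= 1 -> `|bump_poly p h| <= c * `|h| ^+ 2.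
Proof.
have [c c0 Hc] := horner_le p.
exists (c * (size p).+2`!%:R); first by rewrite mulr_ge0.
move=> h; rewrite /bump_poly; case: ifPn => [h0|_]; last first.
  by rewrite normr0 !mulr_ge0// exprn_ge0.
rewrite gtr0_norm// => /andP[_ h1].
have y0 : 0 < h^-1 by rewrite invr_gt0.
have y1 : 1 <= h^-1 by rewrite invr_ge1// unitfE gt_eqF.
rewrite normrM [X in _ * X]ger0_norm ?expR_ge0// expRN.
have E : h^-1 ^+ (size p).+2 / (size p).+2`!%:R <= expR h^-1.
  by apply: le_trans (expR_ge1Dxn (size p).+1 (ltW y0)); rewrite lerDr.
rewrite ler_pdivrMr ?expR_gt0//; apply: (le_trans (Hc _ y1)).
apply: le_trans (ler_wpM2l _ E); last by rewrite !mulr_ge0// ltW.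
rewrite le_eqVlt; apply/orP; left; apply/eqP.
rewrite (exprD _ 2 (size p)) (exprVn h 2).
have : h ^+ 2 != 0 by rewrite expf_neq0 ?gt_eqF.
have : (size p).+2`!%:R != 0 :> R by rewrite pnatr_eq0 -lt0n fact_gt0.
set A := _%:R; set B := h^-1 ^+ _; set C := h ^+ 2 => A0 C0.
by field; rewrite A0 C0.
Qed.

(** With [y = 1 / x] one has [dy/dx = - y ^ 2], so [p(y) exp(- y)] has derivative
    [y ^ 2 (p(y) - p'(y)) exp(- y)]. At the junction [0] the difference quotient is [O(|h|)] by
    flatness. *)
Lemma is_derive_bump_poly p (x : R) : is_derive x (1 : R) (bump_poly p)
  (bump_poly ('X ^+ 2 * (p - p^`())) x).
Proof.
have [x0|x0|->] := ltgtP x 0.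
- rewrite {2}/bump_poly ltNge (ltW x0)/=.
  have near0 : \near x, cst 0 x = bump_poly p x.
    near=> y; rewrite /bump_poly ltNge (_ : y <= 0)//.
    by near: y; exact: cvgr_le (@cvg_id _ _) _ x0.
  exact: near_eq_is_derive near0 (is_derive_cst _ _ _).
- rewrite {2}/bump_poly x0/=.
  have nearP : \near x, p.[x^-1] * expR (- x^-1) = bump_poly p x.
    near=> y; rewrite /bump_poly (_ : 0 < y)//.
    by near: y; exact: cvgr_gt (@cvg_id _ _) _ x0.
  apply: near_eq_is_derive nearP _.
  have xn0 : x != 0 by rewrite gt_eqF.
  have dV : is_derive x (1 : R) (fun y : R => y^-1) (- x ^- 2 * 1).
    exact: (@is_deriveV _ id x 1 1).
  have d1 : is_derive x (1 : R) (fun y : R => p.[y^-1])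
      (p^`().[x^-1] * (- x ^- 2 * 1)).
    exact: (@is_derive1_comp _ (horner p) (fun y => y^-1)).
  have d2 : is_derive x (1 : R) (fun y : R => expR (- y^-1))
      (expR (- x^-1) * - (- x ^- 2 * 1)).
    exact: (@is_derive1_comp _ expR (fun y => - y^-1)).
  have := is_derive_mul d1 d2.
  set D := (X in is_derive _ _ _ X); set D' := (X in _ -> is_derive _ _ _ X).
  by have -> : D = D' by rewrite /D /D' hornerM hornerXn hornerD hornerN exprVn; ring.
- rewrite {2}/bump_poly ltxx.
  have [c c0 Hc] := bump_poly_flat p.
  have lim0 : h^-1 *: ((bump_poly p \o shift 0) (h *: (1 : R)) - bump_poly p 0)
     @[h --> (0 : R)^'] --> (0 : R).
    apply/cvgrPdist_le => e e0; near=> h.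
    rewrite {2}/bump_poly ltxx subr0 sub0r normrN /= addr0.
    rewrite /GRing.scale /= mulr1 normrM normfV.
    have h0 : 0 < `|h| by rewrite normr_gt0; near: h; exact: nbhs_dnbhs_neq.
    rewrite mulrC ler_pdivrMr//.
    apply: (le_trans (Hc h _)).
      by rewrite h0 /=; near: h; exact: dnbhs0_le.
    rewrite expr2 mulrA ler_wpM2r//.
    have he : `|h| <= e / (c + 1) by near: h; apply: dnbhs0_le; rewrite divr_gt0// ltr_wpDl.
    apply: le_trans (_ : (c + 1) * (e / (c + 1)) <= _).
      by apply: ler_pM => //; rewrite lerDl.
    by rewrite mulrCA divff ?mulr1// gt_eqF// ltr_wpDl.
  apply: DeriveDef; first by apply/cvg_ex; exists 0.
  exact: cvg_lim lim0.
Unshelve. all: by end_near. Qed.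

End Smooth.

(** * Test functions *)

Section TestFunctions.
Variable R : realType.
Local Notation mu := (@lebesgue_measure R).
Implicit Types (f phi psi : R -> R).

Lemma smooth_bump_poly (p : {poly R}) : smooth (bump_poly p).
Proof.
apply: (@smooth_coind _ [set h | exists q, h = bump_poly q]); last by exists p.
move=> _ [q ->]; exists (bump_poly ('X ^+ 2 * (q - q^`()))); first by eexists.
by move=> x; exact: is_derive_bump_poly.
Qed.

Lemma test_function_intro phi M : smooth phi ->
  (forall x, M < `|x| -> phi x = 0) -> test_function phi.
Proof.
move=> sphi phi0; split; first exact: sphi.
apply: (subclosed_compact _ (@segment_compact R (- M) M)).
  exact: closed_closure.
have -> : `[- M, M]%classic = closure `[- M, M].
  by apply/closure_id; exact: interval_closed.
apply: closure_subset => x /= phix; rewrite in_itv /= -ler_norml.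
by have [//|/phi0 phix0] := leP `|x| M; rewrite phix0 eqxx in phix.
Qed.

Lemma test_function_supp phi : test_function phi ->
  exists2 M, 0 < M & forall x, M < `|x| -> phi x = 0.
Proof.
move=> [_ /compact_bounded[M [_ HM]]].
exists (`|M| + 1) => [|x Mx]; first by rewrite ltr_wpDl.
have [//|phix] := eqVneq (phi x) 0.
have HM1 : M < `|M| + 1 by rewrite (le_lt_trans (ler_norm M))// ltrDl.
have cx : closure [set x | phi x != 0] x by exact: subset_closure.
by have := HM _ HM1 x cx; rewrite /= leNgt Mx.
Qed.

Lemma test_function_smooth phi : test_function phi -> smooth phi.
Proof. by case. Qed.

Lemma smooth_measurable phi : smooth phi -> measurable_fun setT phi.
Proof. by move=> sphi; exact: continuous_measurable_fun (smooth_continuous sphi). Qed.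

Lemma test_function_bounded phi : test_function phi ->
  exists2 C, 0 < C & forall x, `|phi x| <= C.
Proof.
move=> tphi; have [M M0 HM] := test_function_supp tphi.
have cphi := smooth_continuous (test_function_smooth tphi).
have MM : - M <= M by lra.
have [|c _ Hc] := @EVT_max R (fun x => `|phi x|) _ _ MM.
  apply: continuous_subspaceT => x.
  apply: continuous_comp; [exact: cphi|exact: norm_continuous].
exists (`|phi c| + 1) => [|x]; first by rewrite ltr_wpDl.
have [xM|Mx] := leP `|x| M; last by rewrite HM// normr0 addr_ge0.
apply: le_trans (_ : `|phi c| <= _); last by rewrite lerDl.
by apply: Hc; rewrite in_itv /= -ler_norml.
Qed.

Lemma L1_itv (a b : R) : L1 (fun x : R => (a <= x <= b)%R%:R).
Proof.
have := integrable_indic_itv a b true false.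
congr L1; apply/funext => x; rewrite indicE mem_setE in_itv /=.
by [].
Qed.

Lemma Rint_itv (a b : R) : a <= b ->
  \int[mu]_x ((a <= x <= b)%R%:R : R) = b - a.
Proof.
move=> ab.
have -> : \int[mu]_x ((a <= x <= b)%R%:R : R) = \int[mu]_(x in `[a, b]) (1 : R).
  rewrite [RHS]Rintegral_mkcond; apply: eq_Rintegral => t _.
  by rewrite patchE mem_setE in_itv /=; case: ifP.
have muab : (mu `[a, b] = (b - a)%:E)%E.
  rewrite lebesgue_measure_itv /= lte_fin.
  by case: ltgtP ab => //= -> _; rewrite subrr.
by rewrite Rintegral_cst// mul1r; exact: (congr1 fine muab).
Qed.

Lemma test_function_L1 phi : test_function phi -> L1 phi.
Proof.
move=> tphi; have [M M0 HM] := test_function_supp tphi.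
have [C C0 HC] := test_function_bounded tphi.
apply: (@L1_le _ (fun x => C * (- M <= x <= M)%R%:R)).
- exact: smooth_measurable (test_function_smooth tphi).
- move=> x; rewrite -ler_norml; have [xM|Mx] := leP `|x| M.
    by rewrite mulr1.
  by rewrite HM// normr0 mulr0.
- exact/L1Zl/L1_itv.
Qed.

Lemma test_function_derive phi : test_function phi -> test_function (derive1 phi).
Proof.
move=> tphi; have [M M0 HM] := test_function_supp tphi.
have sphi := test_function_smooth tphi.
apply: (@test_function_intro _ M); first exact: smooth_derive1.
move=> x Mx; rewrite derive1E.
have near0 : \near x, cst 0 x = phi x.
  near=> y; rewrite HM//.
  near: y; apply: (@cvgr_gt _ _ _ _ (fun y : R => `|y|) `|x|) => //.
  exact: norm_continuous.
by have /near_eq_derive <- := near0; rewrite derive_cst.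
Unshelve. all: by end_near. Qed.

(** A test function approximating the indicator of []a, b[] from below: [exp(- 1 / y)] tends to [1]
    as [y] grows, so the factor [n.+1] steepens both edges. *)
Definition plateau (a b : R) (n : nat) (x : R) : R :=
  bump_poly 1 (n.+1%:R * (x - a)) * bump_poly 1 (n.+1%:R * (b - x)).

Lemma bump_poly1_itv (x : R) : 0 <= bump_poly 1 x <= 1.
Proof.
rewrite /bump_poly; case: ifPn => [x0|_]; last by rewrite lexx ler01.
rewrite hornerC mul1r expR_ge0 -[leRHS]expR0 ler_expR.
by rewrite lerNl oppr0 invr_ge0 ltW.
Qed.

Lemma plateau_out (a b : R) n x : ~~ (a < x < b) -> plateau a b n x = 0.
Proof.
rewrite negb_and -!leNgt /plateau /bump_poly => /orP[xa|bx].
  by rewrite ltNge pmulr_rle0// subr_le0 xa/= mul0r.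
by rewrite [in X in _ * X]ltNge pmulr_rle0// subr_le0 bx/= mulr0.
Qed.

Lemma plateau_test (a b : R) n : test_function (plateau a b n).
Proof.
apply: (@test_function_intro _ (Num.max `|a| `|b|)).
  apply: smoothM.
    have := smooth_affine (a := n.+1%:R) (b := - (n.+1%:R * a)) (@smooth_bump_poly 1).
    by congr smooth; apply/funext => x; rewrite -mulrBr.
  have := smooth_affine (a := - n.+1%:R) (b := n.+1%:R * b) (@smooth_bump_poly 1).
  by congr smooth; apply/funext => x; rewrite mulNr addrC -mulrBr.
move=> x; rewrite gt_max => /andP[ax bx]; apply: plateau_out.
apply/negP => /andP[ax' xb'].
have := ler_norm b; have := ler_norm (- a); rewrite normrN => ? ?.
have [x0|x0] := leP 0 x; first by rewrite (ger0_norm x0) in ax bx; lra.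
by rewrite (ltr0_norm x0) in ax bx; lra.
Qed.

Lemma plateau_itv (a b : R) n x : 0 <= plateau a b n x <= 1.
Proof.
have /andP[? ?] := bump_poly1_itv (n.+1%:R * (x - a)).
have /andP[? ?] := bump_poly1_itv (n.+1%:R * (b - x)).
by rewrite mulr_ge0//= mulr_ile1.
Qed.

Lemma bump_poly1_cvg (x : R) : 0 < x ->
  bump_poly 1 (n.+1%:R * x) @[n --> \oo] --> (1 : R).
Proof.
move=> x0.
have H : expR (- (x^-1 * harmonic n)) @[n --> \oo] --> (1 : R).
  rewrite -[X in _ --> X]expR0 -[X in expR X]oppr0 -[X in - X](mulr0 x^-1).
  apply: continuous_cvg; first exact: continuous_expR.
  by apply: cvgN; apply: cvgM; [exact: cvg_cst|exact: cvg_harmonic].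
apply: cvg_trans H; apply: near_eq_cvg; near=> n.
by rewrite /bump_poly mulr_gt0// hornerC mul1r invfM mulrC.
Unshelve. all: by end_near. Qed.

Lemma plateau_cvg (a b x : R) :
  plateau a b n x @[n --> \oo] --> ((a < x < b)%R%:R : R).
Proof.
have [/andP[ax xb]|axb] := boolP (a < x < b); last first.
  have -> : plateau a b ^~ x = cst 0 by apply/funext => n; rewrite plateau_out.
  exact: cvg_cst.
rewrite /= -[X in _ --> X]mulr1.
by apply: cvgM; apply: bump_poly1_cvg; rewrite subr_gt0.
Unshelve. all: by end_near. Qed.

End TestFunctions.

(** * Weak derivatives *)

Section WeakDerivatives.
Variable R : realType.
Local Notation mu := (@lebesgue_measure R).
Implicit Types (u v w phi psi : R -> R).

Lemma kernel_cdf_lt v x : L1 v ->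
  \int[mu]_t ((t < x)%R%:R * v t) = kernel_cdf v x.
Proof.
move=> lv; rewrite /kernel_cdf -Rintegral_itv_bndo_bndc; last first.
  exact: integrableS lv.
rewrite [RHS]Rintegral_mkcond; apply: eq_Rintegral => t _.
rewrite patchE mem_setE in_itv /=.
by case: (t < x); rewrite ?mul1r ?mul0r.
Qed.

Lemma measurable_itvcc (a b : R) : measurable_fun setT (fun t : R => a <= t <= b).
Proof. by apply: measurable_and; exact: measurable_fun_ler. Qed.

Lemma measurable_itvoo (a b : R) : measurable_fun setT (fun t : R => a < t < b).
Proof. by apply: measurable_and; exact: measurable_fun_ltr. Qed.

(** Shared by integrable and by continuous functions, so that the difference of a weak derivative
    and an antiderivative can be tested. *)
Definition locally_L1 w : Prop :=
  forall a b, L1 (fun x => (a <= x <= b)%R%:R * w x).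

Lemma L1_locally_L1 w : L1 w -> locally_L1 w.
Proof. by move=> lw a b; apply: L1_indicM lw; exact: measurable_itvcc. Qed.

Lemma continuous_bounded_itv w (a b : R) : continuous w ->
  exists C, forall x, a <= x <= b -> `|w x| <= C.
Proof.
move=> cw; have [ab|ba] := leP a b; last first.
  by exists 0 => x /andP[ax xb]; move: (le_lt_trans (le_trans ax xb) ba); rewrite ltxx.
have [|c _ Hc] := @EVT_max R (fun x => `|w x|) _ _ ab.
  apply: continuous_subspaceT => x.
  apply: continuous_comp; [exact: cw|exact: norm_continuous].
by exists `|w c| => x xab; apply: Hc; rewrite in_itv.
Qed.

Lemma continuous_locally_L1 w : continuous w -> locally_L1 w.
Proof.
move=> cw a b; have [C HC] := continuous_bounded_itv a b cw.
apply: (@L1_le _ (fun x => C * (a <= x <= b)%R%:R)).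
- apply: measurable_funM; last exact: continuous_measurable_fun.
  exact: measurable_natr (measurable_itvcc a b).
- move=> x; have [xab|] := boolP (a <= x <= b).
    by rewrite mul1r mulr1 HC.
  by rewrite mul0r normr0 mulr0.
- exact/L1Zl/L1_itv.
Qed.

Lemma locally_L1B u v : locally_L1 u -> locally_L1 v ->
  locally_L1 (fun x => u x - v x).
Proof.
move=> lu lv a b; have := L1B (lu a b) (lv a b).
by congr L1; apply/funext => x; rewrite mulrBr.
Qed.

Lemma locally_L1_test w phi : locally_L1 w -> test_function phi ->
  L1 (fun x => w x * phi x).
Proof.
move=> lw tphi; have [M M0 HM] := test_function_supp tphi.
have [C C0 HC] := test_function_bounded tphi.
have := L1_bddM (smooth_measurable (test_function_smooth tphi)) HC (lw (- M) M).
congr L1; apply/funext => x; rewrite -ler_norml.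
have [xM|Mx] := leP `|x| M; first by rewrite mul1r mulrC.
by rewrite HM// mul0r mulr0.
Qed.

(** The fundamental lemma of the calculus of variations in integrated form: insert [plateau] and
    pass to the limit by dominated convergence. Integrals over intervals are all that
    antiderivatives see, so the almost everywhere form is bypassed. *)
Lemma Rint_test_eq0 w : locally_L1 w ->
  (forall phi, test_function phi -> \int[mu]_x (w x * phi x) = 0) ->
  forall a b, \int[mu]_x ((a < x < b)%R%:R * w x) = 0.
Proof.
move=> lw w0 a b.
have Eoc x : (a < x < b)%R%:R * w x = (a < x < b)%R%:R * ((a <= x <= b)%R%:R * w x).
  have [/andP[ax xb]|] := boolP (a < x < b); last by rewrite !mul0r.
  by rewrite (ltW ax) (ltW xb) !mul1r.
have mw : measurable_fun setT (fun x => (a < x < b)%R%:R * w x).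
  rewrite (_ : (fun _ => _) = fun x => (a < x < b)%R%:R * ((a <= x <= b)%R%:R * w x)).
    exact: L1_measurable (L1_indicM (measurable_itvoo a b) (lw a b)).
  exact/funext.
have : \int[mu]_x (w x * plateau a b n x) @[n --> \oo] -->
       \int[mu]_x ((a < x < b)%R%:R * w x).
  apply: (@Rint_dominated _ _ _ (fun x => `|(a <= x <= b)%R%:R * w x|)) => //.
  - by move=> n; exact: L1_measurable (locally_L1_test lw (plateau_test a b n)).
  - exact: L1_norm.
  - move=> n x; have [xab|xab] := boolP (a < x < b); last first.
      by rewrite plateau_out// mulr0 normr0.
    have /andP[p0 p1] := plateau_itv a b n x.
    move: xab => /andP[/ltW -> /ltW ->]; rewrite mul1r normrM ler_piMr//.
    by rewrite ger0_norm.
  - move=> x; rewrite mulrC; apply: cvgM; first exact: cvg_cst.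
    exact: plateau_cvg.
rewrite (_ : (fun n => \int[mu]_x (w x * plateau a b n x)) = cst 0); last first.
  by apply/funext => n; apply: w0; exact: plateau_test.
move=> /(cvg_lim (@Rhausdorff R)) <-.
exact: (lim_cst (@Rhausdorff R)).
Qed.

(** A continuous [w] need not be integrable on the line; truncating it to [[a, b]] leaves it
    unchanged near [x]. *)
Lemma kernel_cdf_local w (a b x : R) : locally_L1 w -> a <= b ->
  a < x < b -> {for x, continuous w} ->
  is_derive x (1 : R) (kernel_cdf (fun t => (a <= t <= b)%R%:R * w t)) (w x).
Proof.
move=> lw ab /andP[ax xb] cw.
have nearw : \near x, w x = (a <= x <= b)%R%:R * w x.
  near=> y.
  have -> : a <= y by near: y; exact: cvgr_ge (@cvg_id _ _) _ ax.
  have -> : y <= b by near: y; exact: cvgr_le (@cvg_id _ _) _ xb.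
  by rewrite mul1r.
have := @kernel_cdf_derive _ (fun t => (a <= t <= b)%R%:R * w t) x (lw a b).
rewrite (ltW ax) (ltW xb) mul1r; apply.
rewrite /prop_for /continuous_at (ltW ax) (ltW xb) mul1r.
by apply: cvg_trans cw; exact: near_eq_cvg.
Unshelve. all: by end_near. Qed.

Lemma kernel_cdf_itv w (a b x y : R) : locally_L1 w ->
  a <= x -> x < y -> y <= b ->
  kernel_cdf (fun t => (a <= t <= b)%R%:R * w t) y -
  kernel_cdf (fun t => (a <= t <= b)%R%:R * w t) x =
  \int[mu]_t ((x < t < y)%R%:R * w t).
Proof.
move=> lw ax xy yb; rewrite -(kernel_cdf_lt _ (lw a b)) kernel_cdfE.
rewrite -RintB; [|exact: L1_indicM (measurable_fun_ltr _ _) (lw a b)|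
  exact: L1_indicM (measurable_le x) (lw a b)].
apply: eq_Rintegral => t _; rewrite mulrA -mulrA -mulrBl.
have [tx|xt] /= := leP t x.
  by rewrite (le_lt_trans tx xy) subrr !mul0r.
have [ty|yt] := ltP t y; last by rewrite subrr !mul0r.
by rewrite subr0 mul1r (le_trans ax (ltW xt)) (le_trans (ltW ty) yb) mul1r.
Qed.

(** All integrals of [w] over intervals vanish, so a local antiderivative is constant near [x]; its
    derivative there is [w x]. *)
Lemma continuous_test_eq0 w : continuous w ->
  (forall phi, test_function phi -> \int[mu]_x (w x * phi x) = 0) ->
  forall x, w x = 0.
Proof.
move=> cw w0 x; have lw := continuous_locally_L1 cw.
have B := Rint_test_eq0 lw w0.
pose H := kernel_cdf (fun t => (x - 1 <= t <= x + 1)%R%:R * w t).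
have x11 : x - 1 <= x + 1 by lra.
have x1x1 : x - 1 < x < x + 1 by apply/andP; split; lra.
have dH : is_derive x (1 : R) H (w x) by exact: kernel_cdf_local lw x11 x1x1 (cw x).
have nearH : \forall y \near x, cst (H (x - 1)) y = H y.
  have xl : x - 1 < x by lra.
  have xr : x < x + 1 by lra.
  near=> y.
  have xy : x - 1 < y by near: y; exact: cvgr_gt (@cvg_id _ _) _ xl.
  have yx : y <= x + 1 by near: y; exact: cvgr_le (@cvg_id _ _) _ xr.
  apply/esym/eqP; rewrite -subr_eq0; apply/eqP.
  by rewrite /= [LHS](kernel_cdf_itv lw (lexx _) xy yx) B.
have dH0 : is_derive x (1 : R) H 0.
  exact: near_eq_is_derive nearH (is_derive_cst _ _ _).
by rewrite -(@derive_val _ _ _ _ _ _ _ dH) (@derive_val _ _ _ _ _ _ _ dH0).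
Unshelve. all: by end_near. Qed.

Lemma test_function_cdf phi : test_function phi ->
  (forall x, phi x = kernel_cdf (derive1 phi) x) /\ \int[mu]_x (derive1 phi x) = 0.
Proof.
move=> tphi; have tphi' := test_function_derive tphi.
have lphi' := test_function_L1 tphi'.
have [M M0 HM] := test_function_supp tphi.
have [M' M'0 HM'] := test_function_supp tphi'.
have sphi := test_function_smooth tphi.
have E x : phi x = kernel_cdf (derive1 phi) x.
  apply/eqP; rewrite -subr_eq0; apply/eqP.
  (* A point to the left of both supports: the difference is constant, and it vanishes at [y]. *)
  pose y := - (M + M') - 1.
  have -> : phi x - kernel_cdf (derive1 phi) x = phi y - kernel_cdf (derive1 phi) y.
    apply: (is_derive_0_is_cst (f := fun x => phi x - kernel_cdf (derive1 phi) x)).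
    move=> z; rewrite -(subrr (derive1 phi z)).
    apply: is_derive_sub; first exact: smooth_is_derive.
    apply: kernel_cdf_derive => //.
    exact: (smooth_continuous (smooth_derive1 sphi)).
  have y0 : y < 0 by rewrite /y; lra.
  rewrite HM; last by rewrite ltr0_norm// /y; lra.
  rewrite kernel_cdfE (_ : (fun _ => _) = cst 0).
    by rewrite Rintegral_cst// mul0r subrr.
  apply/funext => t; have [ty|] := leP t y; last by rewrite mul0r.
  rewrite HM' ?mulr0// ltr0_norm; last exact: le_lt_trans y0.
  by move: ty; rewrite /y; lra.
split => //; apply/eqP; rewrite -normr_le0; apply/ler_addgt0Pl => e e0.
rewrite addr0; have [N N0 HN] := kernel_cdf_oo lphi' e0.
have := HN (N + M) _; rewrite -E HM ?subr0; first by apply; lra.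
by rewrite gtr0_norm; lra.
Qed.

(** Since [v] is merely integrable, there is no product rule to integrate. Instead [phi] is written
    as the integral of its derivative and Fubini is applied; the boundary term is a multiple of the
    integral of [phi'], which is [0]. *)
Lemma Rint_by_parts v phi : L1 v -> test_function phi ->
  \int[mu]_x (v x * phi x) = - \int[mu]_x (kernel_cdf v x * derive1 phi x).
Proof.
move=> lv tphi; have tphi' := test_function_derive tphi.
have lphi' := test_function_L1 tphi'.
have [E I0] := test_function_cdf tphi.
have mle : measurable_fun setT (fun z : R * R => (z.2 <= z.1)%R%:R : R).
  by apply: measurable_natr; exact: measurable_fun_ler.
have H := Rint_Fubini lv lphi' mle (fun x y => norm_natr_le1 R (y <= x)).
transitivity (\int[mu]_x (v x * \int[mu]_y (derive1 phi y * (y <= x)%R%:R))).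
  apply: eq_Rintegral => x _; rewrite {1}E kernel_cdfE; congr (_ * _).
  by apply: eq_Rintegral => y _; rewrite mulrC.
have cvphi : L1 (fun x => kernel_cdf v x * derive1 phi x).
  apply: L1_bddM lphi'; last by move=> x; exact: kernel_cdf_le.
  exact: continuous_measurable_fun (kernel_cdf_continuous lv).
rewrite H /=.
transitivity (\int[mu]_y ((\int[mu]_x v x) * derive1 phi y - kernel_cdf v y * derive1 phi y)).
  apply: eq_Rintegral => y _; rewrite -mulrBl mulrC; congr (_ * _).
  have ml : measurable_fun setT (fun t : R => t < y) by exact: measurable_fun_ltr.
  rewrite -(kernel_cdf_lt _ lv) -(RintB lv (L1_indicM ml lv)).
  apply: eq_Rintegral => x _.
  by have [yx|xy] /= := leP y x; rewrite ?mulr1 ?mulr0 ?mul0r ?mul1r ?subr0 ?subrr.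
rewrite (RintB (L1Zl _ lphi') cvphi).
by rewrite (RintZl _ lphi') I0 mulr0 sub0r.
Qed.

End WeakDerivatives.

(** * From weak to classical derivatives of antiderivatives *)

Section WeakToClassical.
Variable R : realType.
Local Notation mu := (@lebesgue_measure R).
Implicit Types (u v w phi psi : R -> R).

(** The difference has integral [0], so its antiderivative [Psi x - Psi (x + M)] has compact support
    again: far to the left both terms vanish, far to the right both equal the integral of [phi]. *)
Lemma test_function_shiftB phi M : 0 <= M -> test_function phi ->
  exists2 Phi, test_function Phi &
    forall x, derive1 Phi x = phi x - phi (x + M).
Proof.
move=> M0 tphi; have lphi := test_function_L1 tphi.
have [m m0 Hm] := test_function_supp tphi.
have sphi := test_function_smooth tphi.
pose Psi := kernel_cdf phi.
have dPsi x : is_derive x (1 : R) Psi (phi x).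
  by apply: kernel_cdf_derive => //; exact: smooth_continuous sphi x.
have sPsi : smooth Psi by exact: smooth_eq dPsi sphi.
have sPsiM : smooth (fun x => Psi (x + M)).
  have := smooth_affine (a := 1) (b := M) sPsi.
  by congr smooth; apply/funext => x; rewrite mul1r.
exists (fun x => Psi x - Psi (x + M)).
  apply: (@test_function_intro _ _ (m + M)); first exact: smoothB.
  move=> x xmM; apply/eqP; rewrite subr_eq0 /Psi !kernel_cdfE; apply/eqP.
  apply: eq_Rintegral => t _.
  have [tm|mt] := leP `|t| m; last by rewrite Hm// !mulr0.
  congr (_%:R * _); move: tm; rewrite ler_norml => /andP[tm1 tm2].
  have [x0|x0] := leP 0 x.
    rewrite (ger0_norm x0) in xmM.
    have -> : t <= x by lra.
    by have -> : t <= x + M by lra.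
  rewrite (ltr0_norm x0) in xmM.
  have -> : (t <= x) = false by apply/negbTE; rewrite -ltNge; lra.
  by have -> : (t <= x + M) = false by apply/negbTE; rewrite -ltNge; lra.
move=> x; rewrite derive1E; apply: derive_val.
apply: is_derive_sub => //; rewrite -[phi (x + M)]mul1r.
have -> : (fun x => Psi (x + M)) = fun x => Psi (1 * x + M).
  by apply/funext => y; rewrite mul1r.
by apply: is_derive_affine; rewrite mul1r.
Qed.

(** The support of the translate moves to [-oo], where [u] has little mass and [kernel_cdf v] is
    small. The direction matters: at [+oo] the antiderivative tends to the integral of [v], not yet
    known to be [0]. *)
Lemma shift_test_cvg0 u v phi : L1 u -> L1 v -> test_function phi ->
  \int[mu]_x ((u x - kernel_cdf v x) * phi (x + n%:R)) @[n --> \oo] --> (0 : R).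
Proof.
move=> lu lv tphi.
have [m m0 Hm] := test_function_supp tphi.
have [C C0 HC] := test_function_bounded tphi.
have sphi := test_function_smooth tphi.
have mphi (n : nat) : measurable_fun setT (fun x : R => phi (x + n%:R)).
  apply: (measurableT_comp (smooth_measurable sphi)).
  exact: measurable_funD.
have lV : continuous (kernel_cdf v) by exact: kernel_cdf_continuous.
have Lu n : L1 (fun x => phi (x + n%:R) * u x) by exact: L1_bddM (mphi n) _ lu.
have LV n : L1 (fun x => phi (x + n%:R) * kernel_cdf v x).
  pose B := \int[mu]_x `|v x|.
  apply: (@L1_le _ (fun x => C * B * (- m - n%:R <= x <= m - n%:R)%R%:R)).
  - by apply: measurable_funM => //; exact: continuous_measurable_fun.
  - move=> x; have [xm|mx] := leP `|x + n%:R| m; last first.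
      by rewrite Hm// mul0r normr0 !mulr_ge0// ?(ltW C0)//; exact: Rintegral_ge0.
    have -> : (- m - n%:R <= x <= m - n%:R).
      by move: xm; rewrite ler_norml lerBlDr lerBrDr.
    by rewrite mulr1 normrM ler_pM//; exact: kernel_cdf_le.
  - exact/L1Zl/L1_itv.
have E n : \int[mu]_x ((u x - kernel_cdf v x) * phi (x + n%:R)) =
   \int[mu]_x (phi (x + n%:R) * u x) - \int[mu]_x (phi (x + n%:R) * kernel_cdf v x).
  by rewrite -(RintB (Lu n) (LV n)); apply: eq_Rintegral => x _; rewrite mulrC mulrBr.
suff [cu cV] : \int[mu]_x (phi (x + n%:R) * u x) @[n --> \oo] --> (0 : R) /\
    \int[mu]_x (phi (x + n%:R) * kernel_cdf v x) @[n --> \oo] --> (0 : R).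
  rewrite (_ : (fun n : nat => _) = fun n : nat => \int[mu]_x (phi (x + n%:R) * u x) -
      \int[mu]_x (phi (x + n%:R) * kernel_cdf v x)); last by apply/funext => n; exact: E.
  by rewrite -[X in _ --> X](subrr (0 : R)); exact: cvgB.
split.
  have I0 : \int[mu]_x (cst 0 x) = 0 :> R by rewrite Rintegral_cst// mul0r.
  rewrite -[X in _ --> X]I0.
  apply: (@Rint_dominated _ _ _ (fun x => C * `|u x|)).
  - by move=> n; exact: L1_measurable (Lu n).
  - exact: measurable_cst.
  - exact/L1Zl/L1_norm.
  - by move=> n x; rewrite normrM ler_wpM2r.
  - move=> x; apply: (@cvg_trans _ ((fun=> 0 : R) @ \oo)); last exact: cvg_cst.
    apply: near_eq_cvg; near=> n.
    rewrite Hm ?mul0r//.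
    have : `|x| + m + 1 <= n%:R by near: n; exact: nbhs_infty_ger.
    move=> xn; have := ler_norm (- x); rewrite normrN => nx.
    by rewrite ger0_norm; lra.
apply/cvgrPdist_le => e e0.
(* [C] bounds [phi] and [2 m] bounds the length of its support. *)
have e'0 : 0 < e / (C * (m *+ 2)) by rewrite divr_gt0// mulr_gt0// pmulrn_lgt0.
have [A A0 HA] := kernel_cdf_Noo lv e'0.
near=> n; rewrite sub0r normrN.
have nA : A + m < n%:R by near: n; exact: nbhs_infty_gtr.
have mn : - m - n%:R <= m - n%:R by lra.
apply: (@le_trans _ _ (\int[mu]_x (C * (e / (C * (m *+ 2))) * (- m - n%:R <= x <= m - n%:R)%R%:R))).
  apply: Rint_le_norm (LV n) _ _; first exact/L1Zl/L1_itv.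
  move=> x; have [xm|mx] := leP `|x + n%:R| m; last first.
    rewrite Hm// mul0r normr0; apply: mulr_ge0 => //.
    by apply: mulr_ge0; exact: ltW.
  have xmn : (- m - n%:R <= x <= m - n%:R).
    by move: xm; rewrite ler_norml lerBlDr lerBrDr.
  rewrite xmn mulr1 normrM ler_pM//; apply: HA.
  by move: xmn => /andP[_]; lra.
rewrite (RintZl _ (L1_itv _ _)) Rint_itv// le_eqVlt; apply/orP; left; apply/eqP.
have -> : m - n%:R - (- m - n%:R) = m *+ 2 by rewrite mulr2n; ring.
by field; rewrite !gt_eqF.
Unshelve. all: by end_near. Qed.

(* [phi - phi(. + n)] is the derivative of a test function, hence orthogonal to
   [u - kernel_cdf v]; letting the translate escape to -oo leaves no additive
   constant. *)
Lemma weak_derivative_cdf u v : L1 u -> L1 v ->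
  (forall phi, test_function phi ->
    \int[mu]_x (u x * derive1 phi x) = - \int[mu]_x (v x * phi x)) ->
  forall phi, test_function phi ->
    \int[mu]_x (u x * phi x) = \int[mu]_x (kernel_cdf v x * phi x).
Proof.
move=> lu lv uv phi tphi.
have LV : locally_L1 (kernel_cdf v).
  exact/continuous_locally_L1/kernel_cdf_continuous.
have LU : locally_L1 u by exact: L1_locally_L1.
have LW := locally_L1B LU LV.
pose I (n : nat) := \int[mu]_x ((u x - kernel_cdf v x) * phi (x + n%:R)).
have tshift (n : nat) : test_function (fun x => phi (x + n%:R)).
  have [m m0 Hm] := test_function_supp tphi.
  apply: (@test_function_intro _ _ (m + n%:R)).
    have := smooth_affine (a := 1) (b := n%:R) (test_function_smooth tphi).
    by congr smooth; apply/funext => x; rewrite mul1r.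
  move=> x mx; apply: Hm; have := ler_normB (x + n%:R) n%:R.
  by rewrite addrK [ `|n%:R|]ger0_norm//; lra.
have I0 n : I n = \int[mu]_x ((u x - kernel_cdf v x) * phi x).
  have [Phi tPhi HPhi] := test_function_shiftB (ler0n R n) tphi.
  apply/esym/eqP; rewrite -subr_eq0 -(RintB (locally_L1_test LW tphi) (locally_L1_test LW (tshift n))).
  have tPhi' := test_function_derive tPhi.
  rewrite (_ : \int[mu]_x _ = \int[mu]_x (u x * derive1 Phi x) - \int[mu]_x (kernel_cdf v x * derive1 Phi x)).
    by rewrite uv// (Rint_by_parts lv tPhi) opprK subrr.
  rewrite -(RintB (locally_L1_test LU tPhi') (locally_L1_test LV tPhi')).
  by apply: eq_Rintegral => x _; rewrite HPhi; ring.
have := shift_test_cvg0 lu lv tphi; rewrite -/I (_ : I = cst (I 0%N)); last first.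
  by apply/funext => n; rewrite /= !I0.
move=> /(cvg_lim (@Rhausdorff R)); rewrite (lim_cst (@Rhausdorff R)) I0 => /eqP.
have -> : \int[mu]_x ((u x - kernel_cdf v x) * phi x) =
   \int[mu]_x (u x * phi x) - \int[mu]_x (kernel_cdf v x * phi x).
  rewrite -(RintB (locally_L1_test LU tphi) (locally_L1_test LV tphi)).
  by apply: eq_Rintegral => x _; rewrite mulrBl.
by rewrite subr_eq0 => /eqP.
Qed.

(** Equality against test functions gives equal integrals of [u] and [w] over intervals. Near [x],
    [kernel_cdf u] thus differs by a constant from a local antiderivative of [w], so its derivative
    exists everywhere although [u] itself may be discontinuous. *)
Lemma cdf_is_derive u w : L1 u -> continuous w ->
  (forall phi, test_function phi ->
    \int[mu]_x (u x * phi x) = \int[mu]_x (w x * phi x)) ->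
  forall x, is_derive x (1 : R) (kernel_cdf u) (w x).
Proof.
move=> lu cw uw x.
have Lw := continuous_locally_L1 cw.
have Lu := L1_locally_L1 lu.
have B : forall a b, \int[mu]_x ((a < x < b)%R%:R * (u x - w x)) = 0.
  apply: Rint_test_eq0; first exact: locally_L1B.
  move=> phi tphi; have := uw phi tphi => /eqP.
  rewrite -subr_eq0 -(RintB (locally_L1_test Lu tphi) (locally_L1_test Lw tphi)) => /eqP <-.
  by apply: eq_Rintegral => y _; rewrite mulrBl.
pose ind (y : R) : R := (x - 1 <= y <= x + 1)%R%:R.
pose H := kernel_cdf (fun t => ind t * w t).
have x11 : x - 1 <= x + 1 by lra.
have x1x1 : x - 1 < x < x + 1 by apply/andP; split; lra.
have dH : is_derive x (1 : R) H (w x) by exact: kernel_cdf_local Lw x11 x1x1 (cw x).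
have xl : x - 1 < x by lra.
have xr : x < x + 1 by lra.
pose a := x - 1.
have nearH : \forall y \near x, H y + (kernel_cdf u a - H a) = kernel_cdf u y.
  near=> y.
  have ay : a < y by near: y; exact: cvgr_gt (@cvg_id _ _) _ xl.
  have yx : y <= x + 1 by near: y; exact: cvgr_le (@cvg_id _ _) _ xr.
  have E1 : H y - H a = \int[mu]_t ((a < t < y)%R%:R * w t).
    exact: (kernel_cdf_itv Lw (lexx _) ay yx).
  have E2 : kernel_cdf u y - kernel_cdf u a = \int[mu]_t ((a < t < y)%R%:R * u t).
    have mu1 : measurable_fun setT (fun t : R => t < y) by exact: measurable_fun_ltr.
    rewrite -(kernel_cdf_lt _ lu) kernel_cdfE -(RintB (L1_indicM mu1 lu) (L1_indicM (measurable_le a) lu)).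
    apply: eq_Rintegral => t _; rewrite -mulrBl.
    have [ta|] /= := leP t a; last by rewrite subr0.
    by rewrite (le_lt_trans ta ay) subrr.
  have Luay : L1 (fun t => (a < t < y)%R%:R * u t) by exact: L1_indicM (measurable_itvoo a y) lu.
  have Lway : L1 (fun t => (a < t < y)%R%:R * w t).
    have := L1_indicM (measurable_itvoo a y) (Lw a y).
    congr L1; apply/funext => t; have [/andP[at_ ty]|] := boolP (a < t < y); last by rewrite !mul0r.
    by rewrite (ltW at_) (ltW ty) !mul1r.
  have E3 : kernel_cdf u y - kernel_cdf u a = H y - H a.
    apply/eqP; rewrite -subr_eq0 E1 E2 -(RintB Luay Lway) -[X in _ == X](B a y).
    by apply/eqP; apply: eq_Rintegral => t _; rewrite mulrBr.
  by rewrite addrCA -E3 addrC subrK.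
have := is_derive_add dH (is_derive_cst (kernel_cdf u a - H a) x 1).
by rewrite addr0; apply: near_eq_is_derive.
Unshelve. all: by end_near. Qed.

End WeakToClassical.

(** * The chain of antiderivatives of a Sobolev function *)

Section SobolevPrimitives.
Variable R : realType.
Local Notation mu := (@lebesgue_measure R).

Lemma continuous_locally_integrable (w : R -> R) : continuous w ->
  locally_integrable setT w.
Proof.
move=> cw; split; [exact: continuous_measurable_fun|exact: openT|].
move=> A _ cA.
have /integrableP[_] : mu.-integrable A (EFin \o w).
  by apply: continuous_compact_integrable => //; exact: continuous_subspaceT.
by [].
Qed.

(** Two continuous weak derivatives of the same order agree against all test functions, hence
    everywhere, so the choice made by [xget] is immaterial. *)
Lemma continuous_weak_derivativeE j (f g : R -> R) :
  continuous g -> weak_derivative j f g -> continuous_weak_derivative j f = g.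
Proof.
move=> cg wg.
have [cg' wg'] : [set g | continuous g /\ weak_derivative j f g]
    (continuous_weak_derivative j f) by exact: (xgetPex _ (ex_intro _ g (conj cg wg))).
apply/funext => x; apply/eqP; rewrite -subr_eq0; apply/eqP.
apply: (continuous_test_eq0 (w := fun x => continuous_weak_derivative j f x - g x)).
  by move=> y; apply: cvgB; [exact: cg'|exact: cg].
move=> phi tphi.
have Lg := locally_L1_test (continuous_locally_L1 cg) tphi.
have Lg' := locally_L1_test (continuous_locally_L1 cg') tphi.
rewrite (_ : \int[mu]_y _ = \int[mu]_y (continuous_weak_derivative j f y * phi y) -
  \int[mu]_y (g y * phi y)); last first.
  by rewrite -(RintB Lg' Lg); apply: eq_Rintegral => y _; rewrite mulrBl.
have [_ /(_ _ tphi) E] := wg; have [_ /(_ _ tphi)] := wg'; rewrite E.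
have s0 : (-1) ^+ j != 0 :> R by rewrite signr_eq0.
by move/(mulfI s0) => ->; rewrite subrr.
Qed.

(** Here [v j] is a chosen version of the [j]-th weak derivative. The antiderivatives form a chain
    of classical derivatives without any modification of [f] on a null set, and the last one is the
    continuous version of [f^(ell-1)]. *)
Lemma sobolev1_primitives ell (f : R -> R) : sobolev1 ell f ->
  exists2 v : nat -> R -> R, v 0%N = f &
  [/\ forall j, (j <= ell)%N -> L1 (v j),
      forall j, (j < ell)%N -> forall x : R,
        is_derive x (1 : R) (kernel_cdf (v j)) (kernel_cdf (v j.+1) x) &
      (0 < ell)%N -> weak_derivative (ell - 1) f (kernel_cdf (v ell))].
Proof.
move=> [lf Hf].
(* Outside the range [1 <= j <= ell] the value is [f], which is the right one for [j = 0] and a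
   default beyond [ell]. *)
have /choice[v Hv] : forall j, exists g : R -> R,
    (j = 0%N -> g = f) /\
    ((1 <= j <= ell)%N -> weak_derivative j f g /\ L1 g).
  move=> [|j]; first by exists f.
  have [jl|] := boolP (1 <= j.+1 <= ell)%N; last by exists f.
  by have [g wg lg] := Hf _ jl; exists g.
exists v; first by have [->] := Hv 0%N.
have lv j : (j <= ell)%N -> L1 (v j).
  case: j => [|j] jl; first by have [->] := Hv 0%N.
  by have [_ /(_ jl)[]] := Hv j.+1.
have wv j phi : (j <= ell)%N -> test_function phi ->
    \int[mu]_x (f x * derive1n j phi x) = (- 1) ^+ j * \int[mu]_x (v j x * phi x).
  case: j => [|j] jl tphi.
    by have [->] := Hv 0%N; rewrite // expr0 mul1r.
  by have [_ /(_ jl)[[_ ->]]] := Hv j.+1.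
(* The relation of order [j.+1] tested on [phi] is the one of order [j] tested on [phi'], so
   [v j.+1] is a weak derivative of [v j]. *)
have vv j phi : (j < ell)%N -> test_function phi ->
    \int[mu]_x (v j x * phi x) = \int[mu]_x (kernel_cdf (v j.+1) x * phi x).
  move=> jl; move: phi; apply: weak_derivative_cdf; [exact/lv/ltnW|exact: lv|].
  move=> phi tphi; have := wv j.+1 phi jl tphi.
  rewrite derive1Sn (wv j _ (ltnW jl) (test_function_derive tphi)) exprSr -mulrA mulN1r.
  have s0 : (-1) ^+ j != 0 :> R by rewrite signr_eq0.
  by move/(mulfI s0).
split => //.
  move=> j jl; apply: cdf_is_derive; [exact/lv/ltnW| |by move=> phi; exact: vv].
  exact/kernel_cdf_continuous/lv.
case: ell Hf Hv lv wv vv => // ell Hf Hv lv wv vv _; rewrite subn1 /=; split.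
  exact/continuous_locally_integrable/kernel_cdf_continuous/lv.
by move=> phi tphi; rewrite wv// vv.
Qed.

End SobolevPrimitives.

(** * Taylor expansion of the smoothing error *)

Section Taylor.
Variable R : realType.
Local Notation mu := (@lebesgue_measure R).

Lemma MVT_origin (r dr : R -> R) (v : R) :
  (forall x : R, is_derive x (1 : R) r (dr x)) ->
  exists2 c, `|c| <= `|v| & r v - r 0 = dr c * v.
Proof.
move=> dr_.
have cr : continuous r.
  move=> x; apply: differentiable_continuous; apply/derivable1_diffP.
  by have [] := dr_ x.
have [v0|v0] := leP 0 v.
  have [c] := MVT_segment v0 (fun x _ => dr_ x) (continuous_subspaceT cr).
  rewrite in_itv /= subr0 => /andP[c0 cv] E; exists c => //.
  by rewrite !ger0_norm.
have [c] := MVT_segment (ltW v0) (fun x _ => dr_ x) (continuous_subspaceT cr).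
rewrite in_itv /= sub0r => /andP[vc c0] E; exists c.
  by rewrite !ler0_norm ?lerN2// ltW.
by rewrite -opprB E mulrN opprK.
Qed.

Lemma is_derive_sum_ord n (h dh : nat -> R -> R) (x : R) :
  (forall i, is_derive x (1 : R) (h i) (dh i x)) ->
  is_derive x (1 : R) (fun s => \sum_(i < n) h i s) (\sum_(i < n) dh i x).
Proof.
move=> Hh; elim: n => [|n IHn].
  rewrite big_ord0 (_ : (fun _ => _) = cst 0); first exact: is_derive_cst.
  by apply/funext => s; rewrite big_ord0.
rewrite big_ord_recr (_ : (fun _ => _) = fun s => (\sum_(i < n) h i s) + h n s).
  exact: is_derive_add.
by apply/funext => s; rewrite big_ord_recr.
Qed.

Lemma is_derive_monomial (a : R) j (x : R) :
  is_derive x (1 : R) (fun s => a * s ^+ j.+1 / j.+1`!%:R) (a * x ^+ j / j`!%:R).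
Proof.
have dX : is_derive x (1 : R) (fun s : R => s ^+ j.+1) (j.+1%:R * x ^+ j).
  have := @is_derive_poly R 'X^(j.+1) x.
  rewrite derivXn hornerMn hornerXn mulr_natl.
  by congr is_derive; apply/funext => s; rewrite hornerXn.
have := is_derive_scale (a / j.+1`!%:R) dX.
have -> : a / j.+1`!%:R * (j.+1%:R * x ^+ j) = a * x ^+ j / j`!%:R.
  have j0 : j.+1%:R != 0 :> R by rewrite pnatr_eq0.
  have f0 : j`!%:R != 0 :> R by rewrite pnatr_eq0 -lt0n fact_gt0.
  rewrite factS natrM; move: j0 f0; move: (j.+1%:R : R) (j`!%:R : R) => p q p0 q0.
  by field; rewrite p0 q0.
by congr is_derive; apply/funext => s; ring.
Qed.

(** Only continuity of the last function of the chain is at hand, so the remainder is measured by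
    its oscillation [eta]. Induction works because the derivative of the remainder is the remainder,
    one order lower, of the chain shifted by one; the mean value theorem then supplies a factor
    [|v|]. *)
Lemma taylor_le ell (G : nat -> R -> R) (x v eta : R) :
  (forall j, (j < ell)%N -> forall x : R, is_derive x (1 : R) (G j) (G j.+1 x)) ->
  (forall s, `|s| <= `|v| -> `|G ell (x + s) - G ell x| <= eta) ->
  `|G 0%N (x + v) - \sum_(j < ell.+1) G j x * v ^+ j / j`!%:R| <= eta * `|v| ^+ ell.
Proof.
elim: ell G v => [|ell IH] G v dG Heta.
  by rewrite big_ord1 !expr0 mulr1 divr1 mulr1; exact: Heta.
pose r s := G 0%N (x + s) - \sum_(j < ell.+2) G j x * s ^+ j / j`!%:R.
pose dr s := G 1%N (x + s) - \sum_(j < ell.+1) G j.+1 x * s ^+ j / j`!%:R.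
have rdr s : is_derive s (1 : R) r (dr s).
  apply: is_derive_sub.
    rewrite -[G 1%N _]mul1r.
    have -> : (fun s => G 0%N (x + s)) = fun s => G 0%N (1 * s + x).
      by apply/funext => y; rewrite mul1r addrC.
    by apply: is_derive_affine; rewrite mul1r addrC; exact: dG.
  have -> : (fun s => \sum_(j < ell.+2) G j x * s ^+ j / j`!%:R) =
      fun s => G 0%N x + \sum_(j < ell.+1) G j.+1 x * s ^+ j.+1 / j.+1`!%:R.
    by apply/funext => y; rewrite big_ord_recl expr0 mulr1 divr1.
  rewrite -[X in is_derive _ _ _ X]add0r.
  apply: is_derive_add.
  apply: (@is_derive_sum_ord ell.+1 (fun j s => G j.+1 x * s ^+ j.+1 / j.+1`!%:R)
    (fun j s => G j.+1 x * s ^+ j / j`!%:R) s).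
  by move=> i; exact: is_derive_monomial.
have r0 : r 0 = 0.
  rewrite /r addr0 big_ord_recl expr0 mulr1 divr1 big1 ?addr0 ?subrr//.
  by move=> i _; rewrite exprS mul0r mulr0 mul0r.
have [c cv E] := MVT_origin v rdr.
have rv : r v = dr c * v by rewrite -E r0 subr0.
rewrite -/(r v) rv normrM exprSr mulrA ler_wpM2r//.
have eta0 : 0 <= eta.
  by apply: le_trans (Heta 0 _); rewrite ?normr0 ?normr_ge0.
apply: (@le_trans _ _ (eta * `|c| ^+ ell)).
  apply: (IH (fun j => G j.+1)).
    by move=> j jl y; exact: dG.
  by move=> s sc; apply: Heta; exact: le_trans cv.
by rewrite ler_wpM2l// lerXn2r// nnegrE.
Qed.

End Taylor.

(** * Expansion of the smoothing error for small bandwidths *)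

Section Smoothing.
Variable R : realType.
Local Notation mu := (@lebesgue_measure R).

(** The convolution of [F] with [K(. / h) / h], after the substitution that leaves [K] at its own
    scale. *)
Definition smoothing (K F : R -> R) (h x : R) : R :=
  \int[mu]_u (F (x - h * u) * K u).

(** Taylor's formula is integrated against [K]: the moments of order [1] to [ell - 1] vanish, and
    those of order [0] and [ell] give the two explicit terms. The remainder at [u] is at most
    [|t u| ^ ell] times an oscillation of [G ell], which is small for [|u| <= M] and at most [2 B]
    beyond; integrability of [u ^ ell * K u] handles both parts. *)
Lemma smoothing_expansion ell (K : R -> R) (G : nat -> R -> R) (B e : R) :
  (0 < ell)%N -> kernel_of_order ell K ->
  (forall j, (j < ell)%N -> forall x : R, is_derive x (1 : R) (G j) (G j.+1 x)) ->
  (forall x, `|G 0%N x| <= B) -> (forall x, `|G ell x| <= B) ->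
  (forall e, 0 < e -> exists2 d, 0 < d & forall x y, `|x - y| < d ->
    `|G ell x - G ell y| <= e) ->
  0 < e ->
  exists2 t0, 0 < t0 & forall t, 0 < t <= t0 -> forall x,
    `|G 0%N x - smoothing K (G 0%N) t x
      + (- t) ^+ ell * kernel_moment K ell / ell`!%:R * G ell x| <= e * t ^+ ell.
Proof.
move=> l0 [LK K1 K0 _] dG B0 Bl ucG e0.
have B_ge0 : 0 <= B by exact: le_trans (B0 0).
pose I := \int[mu]_u `|u ^+ ell * K u|.
have I0 : 0 <= I by apply: Rintegral_ge0.
(* Each of the two parts is to contribute at most [e / 2 * t ^ ell]; the added [1] keeps the
   denominators positive. *)
have e1 : 0 < e / (2 * (I + 1)) by rewrite divr_gt0// mulr_gt0// ltr_wpDl.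
have e2 : 0 < e / (2 * (2 * B + 1)).
  by rewrite divr_gt0// mulr_gt0// ltr_wpDl// mulr_ge0.
have [d d0 Hd] := ucG _ e1.
have [M M0 HM] := L1_tail (LK _ (leqnn _)) e2.
(* Then [t * |u| <= d / 2 < d] whenever [|u| <= M]. *)
exists (d / (2 * M)) => [|t /andP[t0 tM] x]; first by rewrite divr_gt0// mulr_gt0.
pose Rem u := G 0%N (x - t * u) - \sum_(j < ell.+1) G j x * (- t * u) ^+ j / j`!%:R.
have LG : L1 (fun u => G 0%N (x - t * u) * K u).
  apply: (L1_bddM (C := B)) => //; last first.
    by have := LK 0%N (leq0n _); congr L1; apply/funext => u; rewrite expr0 mul1r.
  have cG : continuous (G 0%N).
    move=> y; apply: differentiable_continuous; apply/derivable1_diffP.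
    by have [] := dG 0%N l0 y.
  apply: (measurableT_comp (continuous_measurable_fun cG)).
  by apply: measurable_funB => //; exact: measurable_funM.
have Lj (j : 'I_ell.+1) : L1 (fun u => G j x * (- t) ^+ j / j`!%:R * (u ^+ j * K u)).
  by apply: L1Zl; apply: LK; rewrite -ltnS.
have ES u : (\sum_(j < ell.+1) G j x * (- t * u) ^+ j / j`!%:R) * K u =
    \sum_(j < ell.+1) G j x * (- t) ^+ j / j`!%:R * (u ^+ j * K u).
  by rewrite mulr_suml; apply: eq_bigr => j _; rewrite exprMn; ring.
have LS : L1 (fun u => (\sum_(j < ell.+1) G j x * (- t * u) ^+ j / j`!%:R) * K u).
  by rewrite (funext ES); exact: L1_sum.
have ERem : \int[mu]_u (Rem u * K u) = smoothing K (G 0%N) t x -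
    \int[mu]_u ((\sum_(j < ell.+1) G j x * (- t * u) ^+ j / j`!%:R) * K u).
  by rewrite /smoothing -(RintB LG LS); apply: eq_Rintegral => u _; rewrite mulrBl.
have EI : \int[mu]_u ((\sum_(j < ell.+1) G j x * (- t * u) ^+ j / j`!%:R) * K u) =
    G 0%N x + (- t) ^+ ell * kernel_moment K ell / ell`!%:R * G ell x.
  rewrite (funext ES) Rint_sum//.
  under eq_bigr => j _ do rewrite (RintZl _ (LK _ (ltn_ord j))).
  rewrite big_ord_recr /=; congr (_ + _); last by rewrite /kernel_moment; ring.
  case: ell l0 K0 {LK dG Bl ucG I I0 e1 e2 Hd HM Rem Lj ES LS ERem} => // ell _ K0.
  rewrite big_ord_recl big1 ?addr0.
    rewrite expr0 !mulr1 divr1 (_ : \int[mu]_x0 _ = 1) ?mulr1// -K1.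
    by apply: eq_Rintegral => u _; rewrite expr0 mul1r.
  move=> i _; rewrite -[\int[mu]_x0 _]/(kernel_moment K (lift ord0 i)) K0 ?mulr0//.
  by rewrite lift0 /= ltnS.
have LRem : L1 (fun u => Rem u * K u).
  by have := L1B LG LS; congr L1; apply/funext => u; rewrite mulrBl.
rewrite -[X in `|X|]opprK normrN (_ : - _ = \int[mu]_u (Rem u * K u)); last first.
  by rewrite ERem EI; ring.
have LKl := LK _ (leqnn ell).
have mM : measurable_fun setT (fun u : R => M < `|u|).
  by apply: measurable_fun_ltr => //; exact: measurableT_comp.
pose c1 := t ^+ ell * (e / (2 * (I + 1))).
pose c2 := t ^+ ell * (2 * B).
have L1' := L1Zl c1 (L1_norm LKl).
have L2' := L1Zl c2 (L1_indicM mM (L1_norm LKl)).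
apply: (@le_trans _ _ (\int[mu]_u (c1 * `|u ^+ ell * K u| +
    c2 * ((M < `|u|)%R%:R * `|u ^+ ell * K u|)))).
  apply: Rint_le_norm LRem (L1D L1' L2') _ => u.
  have tl : 0 <= t ^+ ell by rewrite exprn_ge0// ltW.
  have key (eta : R) :
    (forall s, `|s| <= `|- t * u| -> `|G ell (x + s) - G ell x| <= eta) ->
    `|Rem u * K u| <= t ^+ ell * eta * `|u ^+ ell * K u|.
    move=> /(taylor_le dG) H; rewrite !normrM mulrA ler_wpM2r//.
    rewrite /Rem -mulNr; apply: (le_trans H).
    by rewrite normrM normrN (gtr0_norm t0) exprMn normrX mulrCA mulrA.
  have [uM|Mu] := leP `|u| M.
    rewrite mul0r mulr0 addr0; apply: key => s su; apply: Hd.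
    rewrite addrAC subrr add0r (le_lt_trans su)// normrM normrN (gtr0_norm t0).
    apply: (@le_lt_trans _ _ (d / (2 * M) * M)).
      exact: ler_pM (ltW t0) (normr_ge0 _) tM uM.
    have -> : d / (2 * M) * M = d / 2 by field; rewrite gt_eqF.
    by lra.
  rewrite mul1r -mulrDl; apply: (@le_trans _ _ (c2 * `|u ^+ ell * K u|)).
    apply: key => s _; apply: (le_trans (ler_normB _ _)).
    by rewrite mulrDl mul1r lerD.
  by rewrite ler_wpM2r// lerDr /c1 mulr_ge0// ltW.
rewrite (RintD L1' L2') (RintZl _ (L1_norm LKl)) (RintZl _ (L1_indicM mM (L1_norm LKl))).
rewrite -/I.
apply: (@le_trans _ _ (c1 * I + c2 * (e / (2 * (2 * B + 1))))).
  by rewrite lerD2l ler_wpM2l// /c2 !mulr_ge0// exprn_ge0// ltW.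
rewrite /c1 /c2 -!mulrA -mulrDr [leRHS]mulrC ler_wpM2l ?exprn_ge0 ?(ltW t0)//.
have H1 : e / (2 * (I + 1)) * I <= e / 2.
  rewrite mulrAC ler_pdivrMr; last by rewrite mulr_gt0// ltr_wpDl.
  by nra.
have H2 : 2 * (B * (e / (2 * (2 * B + 1)))) <= e / 2.
  rewrite mulrA mulrA ler_pdivrMr; last by rewrite mulr_gt0// ltr_wpDl// mulr_ge0.
  by nra.
by lra.
Qed.

End Smoothing.

(** * Lower bound for a bandwidth bounded away from zero *)

Section LowerBound.
Variable R : realType.
Local Notation mu := (@lebesgue_measure R).
Variables (K f : R -> R).
Hypotheses (LK : L1 K) (Lf : L1 f).
Local Notation F := (kernel_cdf f).

Lemma measurable_kernel_cdf : measurable_fun setT F.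
Proof. exact: continuous_measurable_fun (kernel_cdf_continuous Lf). Qed.

Lemma L1_smoothing h x : L1 (fun u => F (x - h * u) * K u).
Proof.
apply: (L1_bddM _ (fun u => kernel_cdf_le (x - h * u) Lf) LK).
apply: (measurableT_comp measurable_kernel_cdf).
by apply: measurable_funB => //; exact: measurable_funM.
Qed.

Lemma smoothing_le h x :
  `|smoothing K F h x| <= (\int[mu]_t `|f t|) * \int[mu]_u `|K u|.
Proof.
apply: Rint_bddM_le LK; last by move=> u; exact: kernel_cdf_le.
apply: (measurableT_comp measurable_kernel_cdf).
by apply: measurable_funB => //; exact: measurable_funM.
Qed.

Lemma smoothing_continuous h : continuous (smoothing K F h).
Proof.
move=> x; apply/cvgrPdist_le => e e0.
pose k := \int[mu]_u `|K u|.
have k0 : 0 <= k by apply: Rintegral_ge0.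
have e1 : 0 < e / (k + 1) by rewrite divr_gt0// ltr_wpDl.
have [d d0 Hd] := kernel_cdf_unif_cont Lf e1.
near=> y; rewrite /smoothing -(RintB (L1_smoothing h x) (L1_smoothing h y)).
apply: (@le_trans _ _ (\int[mu]_u (e / (k + 1) * `|K u|))).
  apply: Rint_le_norm (L1B (L1_smoothing h x) (L1_smoothing h y)) _ _.
    exact/L1Zl/L1_norm.
  move=> u; rewrite -mulrBl normrM ler_wpM2r//; apply: Hd.
  rewrite opprB addrA subrK.
  by near: y; exact: cvgr_dist_lt.
rewrite (RintZl _ (L1_norm LK)) -/k mulrAC ler_pdivrMr; last by rewrite ltr_wpDl.
by rewrite ler_wpM2l ?(ltW e0)// lerDl.
Unshelve. all: by end_near. Qed.

(* With X, Y independent of density f, both sides are P(X <= a - Y / r). *)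
Lemma cdf_convolution_swap (r a : R) : 0 < r ->
  \int[mu]_y (f y * F (a - y / r)) = \int[mu]_z (f z * F (r * (a - z))).
Proof.
move=> r0.
have mm : measurable_fun setT (fun z : R * R => (z.2 <= a - z.1 / r)%R%:R : R).
  apply: measurable_natr; apply: measurable_fun_ler => //.
  by apply: measurable_funB => //; exact: measurable_funM.
have := Rint_Fubini Lf Lf mm (fun x y => norm_natr_le1 R (y <= a - x / r)).
rewrite (_ : \int[mu]_x _ = \int[mu]_y (f y * F (a - y / r))); last first.
  apply: eq_Rintegral => y _; rewrite kernel_cdfE; congr (_ * _).
  by apply: eq_Rintegral => z _; rewrite mulrC.
move=> ->; apply: eq_Rintegral => z _; rewrite kernel_cdfE; congr (_ * _).
apply: eq_Rintegral => y _; rewrite mulrC; congr (_%:R * _).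
by rewrite lerBrDr -lerBrDl ler_pdivrMr// mulrC.
Qed.

(** Under the integral against [K], the swap is used at [a - t u] for each [u]; since
    [r (a - t u - z) = r (a - z) - (r t) u], the bandwidth [t] becomes [r t]. *)
Lemma smoothing_convolution_swap (r t a : R) : 0 < r ->
  \int[mu]_y (f y * (F (a - y / r) - smoothing K F t (a - y / r))) =
  \int[mu]_z (f z * (F (r * (a - z)) - smoothing K F (r * t) (r * (a - z)))).
Proof.
move=> r0.
have mf := L1_measurable Lf.
pose B := \int[mu]_s `|f s|.
have mlin (b s : R) : measurable_fun setT (fun y : R => b - y * s).
  by apply: measurable_funB => //; exact: measurable_funM.
have mlin' (b c : R) : measurable_fun setT (fun y : R => c * (b - y)).
  by apply: measurable_funM => //; exact: measurable_funB.
have sw (A : R -> R) (h : R) : measurable_fun setT A ->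
    \int[mu]_y (f y * smoothing K F h (A y)) =
    \int[mu]_u (K u * \int[mu]_y (f y * F (A y - h * u))).
  move=> mA.
  have mm : measurable_fun setT (fun z : R * R => F (A z.1 - h * z.2)).
    apply: (measurableT_comp measurable_kernel_cdf); apply: measurable_funB.
      exact: measurableT_comp.
    exact: measurable_funM.
  rewrite -(Rint_Fubini Lf LK mm (fun x y => kernel_cdf_le _ Lf)).
  apply: eq_Rintegral => y _; congr (_ * _).
  by apply: eq_Rintegral => u _; rewrite mulrC.
have L1F (A : R -> R) : measurable_fun setT A -> L1 (fun y => f y * F (A y)).
  move=> mA; have := L1_bddM (measurableT_comp measurable_kernel_cdf mA)
    (fun y => kernel_cdf_le (A y) Lf) Lf.
  by congr L1; apply/funext => y; rewrite mulrC.
have L1S (A : R -> R) h : measurable_fun setT A -> L1 (fun y => f y * smoothing K F h (A y)).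
  move=> mA; have mS : measurable_fun setT (smoothing K F h).
    exact: continuous_measurable_fun (@smoothing_continuous h).
  have := L1_bddM (measurableT_comp mS mA) (fun y => smoothing_le h (A y)) Lf.
  by congr L1; apply/funext => y; rewrite mulrC.
have E (A : R -> R) h : measurable_fun setT A ->
    \int[mu]_y (f y * (F (A y) - smoothing K F h (A y))) =
    \int[mu]_y (f y * F (A y)) - \int[mu]_y (f y * smoothing K F h (A y)).
  move=> mA; rewrite -(RintB (L1F A mA) (L1S A h mA)).
  by apply: eq_Rintegral => y _; rewrite mulrBr.
apply: (etrans (E _ t (mlin a r^-1))); apply/esym.
apply: (etrans (E _ (r * t) (mlin' a r))); apply/esym.
refine (f_equal2 (fun a b : R => a - b) (cdf_convolution_swap a r0) _).
apply: (etrans (sw _ t (mlin a r^-1))); apply/esym.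
apply: (etrans (sw _ (r * t) (mlin' a r))); apply/esym.
apply: eq_Rintegral => u _; refine (f_equal (fun z : R => K u * z) _).
transitivity (\int[mu]_y (f y * F (a - t * u - y / r))).
  by apply: eq_Rintegral => y _; rewrite addrAC.
rewrite (cdf_convolution_swap (a - t * u) r0); apply: eq_Rintegral => y _.
by congr (_ * F _); ring.
Qed.

(** The density of [Y / r] is an approximate identity as [r] grows, when [Y] has density [f]. *)
Lemma average_cvg (g : R -> R) (B x0 e : R) : (forall x, 0 <= f x) ->
  \int[mu]_t f t = 1 -> continuous g -> (forall x, `|g x| <= B) -> 0 < e ->
  exists2 r0, 0 < r0 & forall r, r0 <= r ->
    `|\int[mu]_y (f y * g (x0 - y / r)) - g x0| <= e.
Proof.
move=> f0 f1 cg gB e0; have B0 : 0 <= B by exact: le_trans (gB 0).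
have e2 : 0 < e / 2 by rewrite divr_gt0.
have e1 : 0 < e / 2 / (2 * B + 1) by rewrite !divr_gt0// ltr_wpDl// mulr_ge0.
have [M M0 HM] := L1_tail Lf e1.
have /cvgrPdist_le /(_ _ e2) := cg x0.
move=> [d /= d0 Hd].
(* Then [|y| / r <= d / 2 < d] whenever [|y| <= M]. *)
exists (2 * M / d) => [|r rM]; first by rewrite divr_gt0// mulr_gt0.
have r0 : 0 < r by rewrite (lt_le_trans _ rM)// divr_gt0// mulr_gt0.
have Lfg : L1 (fun y => f y * g (x0 - y / r)).
  have mg : measurable_fun setT (fun y : R => g (x0 - y / r)).
    apply: (measurableT_comp (continuous_measurable_fun cg)).
    by apply: measurable_funB => //; exact: measurable_funM.
  have := L1_bddM mg (fun y => gB _) Lf.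
  by congr L1; apply/funext => y; rewrite mulrC.
have -> : g x0 = \int[mu]_y (g x0 * f y) by rewrite (RintZl _ Lf) f1 mulr1.
rewrite -(RintB Lfg (L1Zl _ Lf)).
have mM : measurable_fun setT (fun u : R => M < `|u|).
  by apply: measurable_fun_ltr => //; exact: measurableT_comp.
have La := L1Zl (e / 2) Lf.
have Lb := L1Zl (2 * B) (L1_indicM mM (L1_norm Lf)).
apply: (@le_trans _ _ (\int[mu]_y (e / 2 * f y + 2 * B * ((M < `|y|)%R%:R * `|f y|)))).
  apply: Rint_le_norm (L1B Lfg (L1Zl _ Lf)) (L1D La Lb) _ => y.
  rewrite -[g x0 * _]mulrC -mulrBr normrM (ger0_norm (f0 y)).
  have [yM|My] := leP `|y| M.
    rewrite mul0r mulr0 addr0 mulrC ler_wpM2r// distrC.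
    apply: Hd; rewrite /= opprB addrC subrK normrM normfV (gtr0_norm r0).
    rewrite ltr_pdivrMr//; apply: (@le_lt_trans _ _ M) => //.
    apply: (@lt_le_trans _ _ (d * (2 * M / d))); last by rewrite ler_wpM2l// ltW.
    have -> : d * (2 * M / d) = 2 * M by field; rewrite gt_eqF.
    by lra.
  rewrite mul1r -mulrDl mulrC ler_wpM2r//.
  apply: (le_trans (ler_normB _ _)).
  by have := gB (x0 - y / r); have := gB x0; lra.
rewrite (RintD La Lb) (RintZl _ Lf) f1 mulr1 (RintZl _ (L1_indicM mM (L1_norm Lf))).
have H2 : 2 * B * (e / 2 / (2 * B + 1)) <= e / 2.
  rewrite mulrA ler_pdivrMr; last by rewrite ltr_wpDl// mulr_ge0.
  by nra.
have : 2 * B * \int[mu]_y ((M < `|y|)%R%:R * `|f y|) <=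
   2 * B * (e / 2 / (2 * B + 1)) by rewrite ler_wpM2l// mulr_ge0.
by lra.
Qed.

(* Tests the error at bandwidth [h >= d] against [f] at scale [r = h / t]: the
   swap turns it into the error at the fixed small bandwidth [t]. *)
Lemma smoothing_error_lower_bound ell (g : R -> R) (B c x0 : R) :
  (forall x, 0 <= f x) -> \int[mu]_t f t = 1 ->
  continuous g -> (forall x, `|g x| <= B) -> c != 0 -> g x0 != 0 ->
  (forall e, 0 < e -> exists2 t0, 0 < t0 & forall t, 0 < t <= t0 -> forall x,
    `|F x - smoothing K F t x + (- t) ^+ ell * c * g x| <= e * t ^+ ell) ->
  forall d, 0 < d -> exists2 eta, 0 < eta &
    forall h, d <= h -> exists x, eta <= `|F x - smoothing K F h x|.
Proof.
move=> f0 f1 cg gB c0 g0 HT d d0.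
have cg0 : 0 < `|c| * `|g x0| by rewrite mulr_gt0// normr_gt0.
have e40 : 0 < `|c| * `|g x0| / 4 by rewrite divr_gt0.
have [t1 t10 Ht] := HT _ e40.
have g20 : 0 < `|g x0| / 2 by rewrite divr_gt0// normr_gt0.
have [r0 r00 Hr] := average_cvg x0 f0 f1 cg gB g20.
(* The first bound makes the expansion valid at [t]; the second gives [h / t >= r0] for every
   [h >= d]. *)
pose t := Num.min t1 (d / r0).
have t0 : 0 < t by rewrite lt_min t10 divr_gt0.
have tt1 : t <= t1 by rewrite ge_min lexx.
have tl : 0 < t ^+ ell by rewrite exprn_gt0.
(* In units of [t ^ ell * |c| * |g x0|], the averaged main term is at least [1/2] and the error of
   the expansion at most [1/4]. If the claim failed, the left-hand average would be at most [1/8],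
   and [1/4 + 1/8 < 1/2]. *)
exists (t ^+ ell * (`|c| * `|g x0| / 8)); first by rewrite mulr_gt0// divr_gt0.
move=> h dh; apply: contrapT => /forallNP Hx.
have h0 : 0 < h by exact: lt_le_trans dh.
pose r := h / t.
have rr0 : r0 <= r.
  rewrite ler_pdivlMr//; apply: le_trans dh.
  apply: (@le_trans _ _ (r0 * (d / r0))); first by rewrite ler_wpM2l ?(ltW r00)// ge_min lexx orbT.
  by rewrite mulrCA divff ?mulr1// gt_eqF.
have r_gt0 : 0 < r by exact: lt_le_trans rr0.
have rt : r * t = h by rewrite divfK// gt_eqF.
pose D s x := F x - smoothing K F s x.
have cD s : continuous (D s).
  by move=> x; apply: cvgB; [exact: kernel_cdf_continuous|exact: smoothing_continuous].
have LfM C (b : R -> R) : measurable_fun setT b -> (forall x, `|b x| <= C) ->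
    L1 (fun y => f y * b y).
  move=> mb bC; have := L1_bddM mb bC Lf.
  by congr L1; apply/funext => y; rewrite mulrC.
have DB s x : `|D s x| <= (\int[mu]_t `|f t|) + (\int[mu]_t `|f t|) * \int[mu]_u `|K u|.
  apply: (le_trans (ler_normB _ _)); apply: lerD; first exact: kernel_cdf_le.
  exact: smoothing_le.
have mlin (b s : R) : measurable_fun setT (fun y : R => b - y * s).
  by apply: measurable_funB => //; exact: measurable_funM.
have LfD : L1 (fun y => f y * D t (x0 - y / r)).
  apply: LfM => [|y]; last exact: DB.
  exact: (measurableT_comp (continuous_measurable_fun (@cD t)) (mlin x0 r^-1)).
have L1g : L1 (fun y => f y * g (x0 - y / r)).
  apply: LfM => [|y]; last exact: gB.
  exact: (measurableT_comp (continuous_measurable_fun cg) (mlin x0 r^-1)).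
have Rint_cst (C : R) : C = \int[mu]_x (C * f x) by rewrite (RintZl _ Lf) f1 mulr1.
have up : `|\int[mu]_y (f y * D t (x0 - y / r))| <= t ^+ ell * (`|c| * `|g x0| / 8).
  rewrite /D (smoothing_convolution_swap t x0 r_gt0) rt.
  rewrite [leRHS]Rint_cst; apply: Rint_le_norm.
  - apply: LfM => [|z]; last exact: (DB h).
    have ml : measurable_fun setT (fun z : R => r * (x0 - z)).
      by apply: measurable_funM => //; exact: measurable_funB.
    exact: (measurableT_comp (continuous_measurable_fun (@cD h)) ml).
  - exact: L1Zl.
  - move=> z; rewrite normrM (ger0_norm (f0 z)) mulrC ler_wpM2r//.
    by have /negP := Hx (r * (x0 - z)); rewrite -ltNge => /ltW.
have app : `|\int[mu]_y (f y * D t (x0 - y / r)) +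
    (- t) ^+ ell * c * \int[mu]_y (f y * g (x0 - y / r))| <=
    `|c| * `|g x0| / 4 * t ^+ ell.
  rewrite -(RintZl _ L1g) -(RintD LfD (L1Zl _ L1g)).
  rewrite [leRHS]Rint_cst; apply: Rint_le_norm.
  - exact: L1D LfD (L1Zl _ L1g).
  - exact: L1Zl.
  - move=> y; rewrite mulrCA -mulrDr normrM (ger0_norm (f0 y)) mulrC ler_wpM2r//.
    by apply: Ht; rewrite t0.
have avg := Hr r rr0.
set J := \int[mu]_y (f y * g (x0 - y / r)) in avg app.
set I := \int[mu]_y (f y * D t (x0 - y / r)) in up app.
have Jg : `|g x0| / 2 <= `|J|.
  have := ler_normB (J - g x0) J; rewrite addrAC subrr add0r normrN.
  by lra.
have : `|(- t) ^+ ell * c * J| <= `|c| * `|g x0| / 4 * t ^+ ell + t ^+ ell * (`|c| * `|g x0| / 8).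
  have := ler_normB (I + (- t) ^+ ell * c * J) I; rewrite addrAC subrr add0r.
  by lra.
rewrite !normrM normrX normrN (gtr0_norm t0).
have : t ^+ ell * (`|c| * (`|g x0| / 2)) <= t ^+ ell * (`|c| * `|J|).
  by rewrite ler_wpM2l ?(ltW tl)// ler_wpM2l.
have : 0 < t ^+ ell * (`|c| * `|g x0|) by rewrite mulr_gt0.
by rewrite -!mulrA; lra.
Qed.

End LowerBound.

(** * Distances and deterministic asymptotics *)

Section Distances.
Variable R : realType.
Implicit Types (F G H : R -> R).

Definition vanishes_at_Noo H : Prop :=
  forall e, 0 < e -> exists2 M, 0 < M & forall x, x < - M -> `|H x| <= e.

(** What the asymptotics require of a distance: stability under uniform perturbations of [F - G],
    homogeneity and control of values. Homogeneity is an upper bound with a real [m], which avoids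
    infinite values; scaling back by [c^-1] gives the reverse bound. Control of values is limited to
    functions vanishing at [-oo] because Kuiper distances ignore additive constants. *)
Definition sup_like (d : (R -> R) -> (R -> R) -> \bar R) (L : R) : Prop :=
  [/\ 0 <= L, (d (fun=> 0%R) (fun=> 0%R) <= 0)%E,
      forall F G F' G' r, (forall x, `|(F x - G x) - (F' x - G' x)| <= r) ->
        (d F G <= d F' G' + (L * r)%:E)%E,
      forall (c : R) H (m : R), (d H (fun=> 0%R) <= m%:E)%E ->
        (d (fun x => c * H x)%R (fun=> 0%R) <= (`|c| * m)%:E)%E &
      forall H x, vanishes_at_Noo H -> (`|H x|%:E <= d H (fun=> 0%R))%E].

Lemma sup_like_dist_sup : sup_like (@dist_sup R) 1.
Proof.
split => //.
- by apply: ub_ereal_sup => _ [x _ <-]; rewrite subr0 normr0.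
- move=> F G F' G' r Hr; apply: ub_ereal_sup => _ [x _ <-].
  apply: (@le_trans _ _ (`|F' x - G' x|%:E + (1 * r)%:E)%E).
    rewrite -EFinD lee_fin mul1r -lerBlDl.
    by apply: le_trans (Hr x); exact: lerB_dist.
  by rewrite leeD2r//; apply: ereal_sup_ubound; exists x.
- move=> c H m Hm; apply: ub_ereal_sup => _ [x _ <-].
  rewrite subr0 normrM lee_fin ler_wpM2l// -lee_fin.
  apply: le_trans Hm; apply: ereal_sup_ubound; exists x => //.
  by rewrite subr0.
- by move=> H x _; apply: ereal_sup_ubound; exists x => //; rewrite subr0.
Qed.

(** The constant counts the [2 k] endpoints of the [k] increments, each perturbed by at most [r]. *)
Lemma sup_like_dist_kuiper k : (1 <= k)%N -> sup_like (@dist_kuiper R k) (2 * k%:R).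
Proof.
move=> k1; split.
- by rewrite mulr_ge0.
- apply: ub_ereal_sup => _ [ab _ <-]; rewrite lee_fin big1// => i _.
  by rewrite !subrr normr0.
- move=> F G F' G' r Hr; apply: ub_ereal_sup => _ [ab abk <-].
  apply: (@le_trans _ _ ((\sum_(i < k) `|(F' (ab.2 i) - F' (ab.1 i)) -
      (G' (ab.2 i) - G' (ab.1 i))|)%:E + (2 * k%:R * r)%:E)%E); last first.
    by rewrite leeD2r//; apply: ereal_sup_ubound; exists ab.
  rewrite -EFinD lee_fin.
  have -> : 2 * k%:R * r = \sum_(i < k) (2 * r).
    by rewrite sumr_const card_ord -mulr_natr; ring.
  rewrite -big_split /=; apply: ler_sum => i _.
  rewrite -lerBlDl; apply: (le_trans (lerB_dist _ _)).
  have := Hr (ab.1 i); have := Hr (ab.2 i).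
  set u := (X in `|X| <= r); set v := (X in _ -> `|X| <= r -> _) => Hu Hv.
  apply: (@le_trans _ _ (`|u| + `|v|)); last by lra.
  rewrite (_ : _ - _ = u - v); first exact: ler_normB.
  by rewrite /u /v; ring.
- move=> c H m Hm; apply: ub_ereal_sup => _ [ab abk <-].
  rewrite lee_fin (_ : \sum_(i < k) _ = `|c| * \sum_(i < k) `|H (ab.2 i) - H (ab.1 i) - (0 - 0)|).
    rewrite ler_wpM2l// -lee_fin; apply: le_trans Hm.
    by apply: ereal_sup_ubound; exists ab.
  rewrite mulr_sumr; apply: eq_bigr => i _.
  by rewrite -normrM; congr `|_|; ring.
- move=> H x H0; apply/lee_addgt0Pr => e e0.
  have [M M0 HM] := H0 e e0.
  pose y := Num.min x (- M - 1).
  have yx : y <= x by rewrite ge_min lexx.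
  have yM : y < - M by rewrite gt_min; apply/orP; right; lra.
  apply: (@le_trans _ _ (`|H x - H y|%:E + e%:E)%E).
    rewrite -EFinD lee_fin; have := ler_normD (H x - H y) (H y).
    by rewrite subrK; have := HM y yM; lra.
  rewrite leeD2r//.
  (* The first interval is [[y, x]] with [H y] small; all the others are degenerate at [x]. *)
  pose a (i : nat) : R := if i == 0%N then y else x.
  apply: (@le_trans _ _ (\sum_(i < k) `|H x - H (a i) - (0 - 0)|)%:E).
    rewrite lee_fin; case: k k1 => // k _.
    by rewrite big_ord_recl /= /a/= subrr subr0 lerDl sumr_ge0.
  apply: ereal_sup_ubound; exists (a, fun=> x) => //=; split => // i _.
  by rewrite /a; case: ifP.
Qed.

End Distances.

(** * Deterministic asymptotics of the bandwidth *)

Section Asymptotics.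
Variable R : realType.

Lemma powR_near1 (p e : R) : 0 < e ->
  exists2 d, 0 < d & forall x, `|x - 1| <= d -> `|x `^ p - 1| <= e.
Proof.
move=> e0.
have c1 : {for 1, continuous (fun x : R => x `^ p)}.
  apply: differentiable_continuous; apply/derivable1_diffP.
  by have [] := @is_derive1_powR R p 1 ltr01.
move/cvgrPdist_le : c1 => /(_ _ e0)[d /= d0 Hd].
exists (d / 2) => [|x xd]; first by rewrite divr_gt0.
have -> : 1 = 1 `^ p :> R by rewrite powR1.
rewrite distrC; apply: Hd; rewrite /= distrC.
by apply: (le_lt_trans xd); lra.
Qed.

Lemma powRN_cvg0 (a e : R) : 0 < a -> 0 < e ->
  \forall n \near \oo, n%:R `^ (- a) <= e.
Proof.
move=> a0 e0; near=> n.
have n0 : (0 : R) < n%:R by rewrite ltr0n; near: n; exact: nbhs_infty_gt.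
have ne : (e^-1) `^ (a^-1) <= n%:R by near: n; exact: nbhs_infty_ger.
rewrite powRN invf_ple ?posrE ?powR_gt0//.
have -> : e^-1 = (e^-1 `^ a^-1) `^ a.
  by rewrite -powRrM mulVf ?gt_eqF// powRr1// invr_ge0 ltW.
by rewrite ge0_ler_powR// ?nnegrE ?powR_ge0// ltW.
Unshelve. all: by end_near. Qed.

(** The argument along one sample path: [D] is the error for the true distribution function, and
    [r n] bounds the deviation of the empirical one. The distance of [D (h n)] from [0] is [c * p n]
    up to [o(p n)]; by [H1] this forces [h n] to [0], and then [H3] identifies the same distance
    with [h n ^ ell * A] up to [o(h n ^ ell)]. *)
Lemma bandwidth_asymptotics ell (d : (R -> R) -> (R -> R) -> \bar R)
    (D : R -> R -> R) (g : R -> R) (L C c gamma kappa B x0 : R)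
    (Fn Fh : nat -> R -> R) (h r : nat -> R) :
  (0 < ell)%N -> sup_like d L -> 0 <= C -> 0 < c -> 0 < gamma -> kappa != 0 ->
  (forall t, 0 < t -> exists2 eta, 0 < eta &
    forall s, t <= s -> exists x, eta <= `|D s x|) ->
  (forall s, 0 < s -> vanishes_at_Noo (D s)) ->
  (forall e, 0 < e -> exists2 t0, 0 < t0 & forall t, 0 < t <= t0 -> forall x,
    `|D t x + (- t) ^+ ell * kappa * g x| <= e * t ^+ ell) ->
  (forall x, `|g x| <= B) -> vanishes_at_Noo g -> g x0 != 0 ->
  (forall e, 0 < e -> \forall n \near \oo, r n <= e * n%:R `^ (- gamma)) ->
  (\forall n \near \oo, [/\ 0 < h n, d (Fn n) (Fh n) = (c * n%:R `^ (- gamma))%:E &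
    forall x, `|(Fn n x - Fh n x) - D (h n) x| <= C * r n]) ->
  exists2 e : nat -> R, e @ \oo --> (0 : R) & \forall n \near \oo,
    h n = (c / (`|kappa| * fine (d g (fun=> 0%R)))) `^ ell%:R^-1
          * n%:R `^ (- (gamma / ell%:R)) * (1 + e n).
Proof.
move=> l0 [L0 d00 dD dZ dge] C0 c0 gam0 kap0 H1 H2 H3 gB g0 gx0 Hr Hd.
have dle (H : R -> R) (b : R) : (forall x, `|H x| <= b) -> (d H (fun=> 0%R) <= (L * b)%:E)%E.
  move=> Hb; rewrite -[leRHS]add0e; apply: (@le_trans _ _ (d (fun=> 0%R) (fun=> 0%R) + (L * b)%:E)%E).
    by apply: dD => x; rewrite !subr0.
  by rewrite leeD2r.
pose N := fine (d g (fun=> 0%R)).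
have dN : d g (fun=> 0%R) = N%:E.
  rewrite fineK// ge0_fin_numE; last exact: le_trans (dge g x0 g0).
  by apply: (le_lt_trans (dle _ _ gB)); rewrite ltry.
have N0 : 0 < N.
  have : (`|g x0|%:E <= N%:E)%E by rewrite -dN; exact: dge.
  by rewrite lee_fin; apply: lt_le_trans; rewrite normr_gt0.
rewrite -/N; pose A := `|kappa| * N; rewrite -/A.
have A0 : 0 < A by rewrite mulr_gt0// normr_gt0.
pose p (n : nat) : R := n%:R `^ (- gamma).
have LC0 : 0 < L * C + 1 by rewrite ltr_wpDl// mulr_ge0.
have L10 : 0 < L + 1 by rewrite ltr_wpDl.
have up tau : 0 < tau -> \forall n \near \oo,
    (d (D (h n)) (fun=> 0%R) <= (c * p n + tau * p n)%:E)%E /\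
    ((c * p n)%:E <= d (D (h n)) (fun=> 0%R) + (tau * p n)%:E)%E.
  move=> tau0; have e0 : 0 < tau / (L * C + 1) by rewrite divr_gt0.
  near=> n.
  have [hn dn close] : [/\ 0 < h n, d (Fn n) (Fh n) = (c * p n)%:E &
    forall x, `|(Fn n x - Fh n x) - D (h n) x| <= C * r n] by near: n.
  have rn : L * (C * r n) <= tau * p n.
    have rn : r n <= tau / (L * C + 1) * p n by near: n; exact: Hr.
    rewrite mulrA; apply: (le_trans (ler_wpM2l _ rn)); first by rewrite mulr_ge0.
    rewrite mulrA ler_wpM2r ?powR_ge0// mulrA ler_pdivrMr//.
    by rewrite mulrC ler_wpM2l ?(ltW tau0)// lerDl.
  split.
    rewrite EFinD -dn; apply: (@le_trans _ _ (d (Fn n) (Fh n) + (L * (C * r n))%:E)%E).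
      by apply: dD => x; rewrite subr0 distrC.
    by rewrite leeD2l// lee_fin.
  rewrite -dn; apply: (@le_trans _ _ (d (D (h n)) (fun=> 0%R) + (L * (C * r n))%:E)%E).
    by apply: dD => x; rewrite subr0.
  by rewrite leeD2l// lee_fin.
have h0 : \forall n \near \oo, 0 < h n by apply: filterS Hd => n [].
have hsmall t : 0 < t -> \forall n \near \oo, h n <= t.
  move=> t0; have [eta eta0 Heta] := H1 t t0.
  (* Eventually [|D (h n) x| <= (c + 1) * p n <= eta / 2], which contradicts a value of at least
     [eta]. *)
  have eta1 : 0 < eta / (2 * (c + 1)) by rewrite divr_gt0// mulr_gt0// addr_gt0.
  near=> n; rewrite leNgt; apply/negP => /ltW /Heta[x Hx].
  have hn : 0 < h n by near: n.
  have [up1 _] : (d (D (h n)) (fun=> 0%R) <= (c * p n + 1 * p n)%:E)%E /\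
    ((c * p n)%:E <= d (D (h n)) (fun=> 0%R) + (1 * p n)%:E)%E by near: n; exact: up.
  have := le_trans (dge _ x (H2 _ hn)) up1; rewrite lee_fin -mulrDl => H.
  have pn : p n <= eta / (2 * (c + 1)) by near: n; exact: powRN_cvg0.
  have : (c + 1) * p n <= (c + 1) * (eta / (2 * (c + 1))).
    by rewrite ler_wpM2l// addr_ge0// ltW.
  have -> : (c + 1) * (eta / (2 * (c + 1))) = eta / 2.
    by field; rewrite gt_eqF// addr_gt0.
  by lra.
have ratio del : 0 < del -> \forall n \near \oo,
    `|h n ^+ ell * A / (p n * c) - 1| <= del.
  move=> del0.
  (* With [T = h n ^ ell], the bounds [tau <= 1] and [tau <= A / 2] give [T <= 2 (c + 1) / A * p n].
     Hence the total error [tau * (T + p n)] is at most [tau * k * p n], and the last bound on [tau]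
     makes this at most [del * c * p n]. *)
  pose k := 2 * (c + 1) / A + 1.
  have k0 : 0 < k by rewrite addr_gt0// divr_gt0// mulr_gt0// addr_gt0.
  pose tau := Num.min (Num.min 1 (A / 2)) (del * c / k).
  have tau0 : 0 < tau by rewrite !lt_min ltr01 !divr_gt0// mulr_gt0.
  have tau1 : tau <= 1 by rewrite !ge_min lexx.
  have tauA : tau <= A / 2 by rewrite !ge_min lexx orbT.
  have tauk : tau * k <= del * c by rewrite -ler_pdivlMr// ge_min lexx orbT.
  have e0 : 0 < tau / (L + 1) by rewrite divr_gt0.
  have [t0 t00 Ht] := H3 _ e0.
  near=> n.
  have hn : 0 < h n by near: n.
  have ht : h n <= t0 by near: n; exact: hsmall.
  have [up1 up2] : (d (D (h n)) (fun=> 0%R) <= (c * p n + tau * p n)%:E)%E /\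
    ((c * p n)%:E <= d (D (h n)) (fun=> 0%R) + (tau * p n)%:E)%E by near: n; exact: up.
  have n0 : (0 : R) < n%:R by rewrite ltr0n; near: n; exact: nbhs_infty_gt.
  have pn : 0 < p n by exact: powR_gt0.
  pose T := h n ^+ ell; have T0 : 0 < T by rewrite exprn_gt0.
  pose a := - ((- h n) ^+ ell * kappa).
  have Na : `|a| = T * `|kappa| by rewrite normrN normrM normrX normrN (gtr0_norm hn).
  have HhT x : `|D (h n) x - 0 - (a * g x - 0)| <= tau / (L + 1) * T.
    by rewrite !subr0 /a mulNr opprK; apply: Ht; rewrite hn.
  have LT : L * (tau / (L + 1) * T) <= tau * T.
    rewrite mulrA ler_wpM2r ?(ltW T0)// mulrA ler_pdivrMr// mulrC.
    by rewrite ler_wpM2l ?(ltW tau0)// lerDl.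
  have dag : (d (fun x => (a * g x)%R) (fun=> 0%R) <= (T * A)%:E)%E.
    by rewrite /A mulrA -Na; apply: dZ; rewrite dN.
  have Hup : c * p n <= T * A + tau * T + tau * p n.
    rewrite -lee_fin !EFinD; apply: (le_trans up2); rewrite leeD2r//.
    apply: (@le_trans _ _ (d (fun x => (a * g x)%R) (fun=> 0%R) + (L * (tau / (L + 1) * T))%:E)%E).
      exact: dD.
    by apply: leeD; rewrite ?lee_fin.
  have Hlo : T * A <= c * p n + tau * p n + tau * T.
    have da : (d (fun x => (a * g x)%R) (fun=> 0%R) <= (c * p n + tau * p n + tau * T)%:E)%E.
      apply: (@le_trans _ _ (d (D (h n)) (fun=> 0%R) + (L * (tau / (L + 1) * T))%:E)%E).
        by apply: dD => x; rewrite distrC.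
      by rewrite EFinD; apply: leeD; rewrite ?lee_fin.
    have a0 : a != 0 by rewrite -normr_gt0 Na mulr_gt0// normr_gt0.
    (* The lower bound for the distance of [a * g] comes from scaling back to [g]. *)
    have := dZ a^-1 _ _ da.
    rewrite (_ : (fun x => a^-1 * (a * g x)) = g); last first.
      by apply/funext => x; rewrite mulKf.
    rewrite dN lee_fin normfV ler_pdivlMl ?normr_gt0// Na.
    by rewrite /A mulrA.
  have TA : T * A <= 2 * (c + 1) * p n.
    have : tau * T <= A / 2 * T by rewrite ler_wpM2r// ltW.
    have : tau * p n <= 1 * p n by rewrite ler_wpM2r// ltW.
    by lra.
  have TpA : T <= 2 * (c + 1) / A * p n by rewrite mulrAC ler_pdivlMr.
  have key : tau * (T + p n) <= del * (p n * c).
    apply: (@le_trans _ _ (tau * (k * p n))).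
      by rewrite ler_wpM2l ?(ltW tau0)// mulrDl mul1r lerD2r.
    by rewrite mulrA [p n * c]mulrC [leRHS]mulrA ler_wpM2r// ltW.
  have pc : 0 < p n * c by rewrite mulr_gt0.
  rewrite -/T -(@divff _ (p n * c)) ?gt_eqF// -mulrBl normrM normfV (gtr0_norm pc).
  rewrite ler_pdivrMr//; apply: le_trans key.
  by rewrite ler_norml; apply/andP; split; lra.
(* This ratio tends to [1], and [h n ^ ell = c / A * p n * x n]; the relative error comes from its
   [ell]-th root. *)
pose x n := h n ^+ ell * A / (p n * c).
exists (fun n => x n `^ ell%:R^-1 - 1).
  apply/cvgrPdist_le => e e0; have [del del0 Hdel] := powR_near1 ell%:R^-1 e0.
  near=> n; rewrite sub0r normrN; apply: Hdel.
  by near: n; exact: ratio.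
near=> n.
have hn : 0 < h n by near: n.
have n0 : (0 : R) < n%:R by rewrite ltr0n; near: n; exact: nbhs_infty_gt.
have pn : 0 < p n by exact: powR_gt0.
rewrite addrC subrK -mulNr powRrM -/(p n).
have x0' : 0 <= x n by rewrite ltW// divr_gt0// mulr_gt0// exprn_gt0.
rewrite -powRM ?(ltW pn)//; last by rewrite ltW// divr_gt0.
rewrite -powRM//; last by rewrite mulr_ge0// ltW// divr_gt0.
have -> : c / A * p n * x n = h n ^+ ell by rewrite /x; field; rewrite !gt_eqF.
rewrite -powR_mulrn ?(ltW hn)// -powRrM divff ?pnatr_eq0 ?gt_eqF//.
by rewrite powRr1// ltW.
Unshelve. all: by end_near. Qed.

End Asymptotics.

(** * Empirical distribution functions *)

Section Chernoff.
Context (disp : measure_display) (T : measurableType disp) (R : realType).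
Variables (P : probability T R) (X : nat -> {RV P >-> R}).

Lemma measurable_pred (p : T -> bool) : measurable_fun setT p ->
  measurable [set w | p w].
Proof.
move=> mp; have := mp measurableT [set true] I; rewrite setTI.
by congr measurable; apply/seteqP; split => w /=.
Qed.

Lemma prod_1D_natr n (s : R) (b : 'I_n -> bool) :
  \prod_(i < n) (s * (b i)%:R + 1) =
  \sum_(J : {set 'I_n}) s ^+ #|J| * [forall i in J, b i]%:R.
Proof.
rewrite (@bigA_distr R 0 1 *%R +%R 'I_n (fun i => s * (b i)%:R) (fun=> 1)).
apply: eq_bigr => J _; rewrite -big_mkcond /= big_split /= prodr_const.
congr (_ * _); case: forallP => H /=.
  by rewrite big1// => i iJ; have := H i; rewrite iJ /= => ->.
have /existsP[i] : [exists i, ~~ ((i \in J) ==> b i)].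
  by rewrite -negb_forall; apply/forallP.
by rewrite negb_imply => /andP[iJ /negbTE bi]; rewrite (bigD1 i)//= bi mul0r.
Qed.

Lemma sum_expr_card n (s : R) :
  \sum_(J : {set 'I_n}) s ^+ #|J| = (s + 1) ^+ n.
Proof.
have := @bigA_distr R 0 1 *%R +%R 'I_n (fun=> s) (fun=> 1).
rewrite prodr_const card_ord => ->; apply: eq_bigr => J _.
by rewrite -big_mkcond /= prodr_const.
Qed.

Lemma independent_same_event n (J : {set 'I_n}) (b : R -> bool) (p : R) :
  mutually_independent X -> measurable [set x | b x] ->
  (forall i, P [set w | b (X i w)] = p%:E) ->
  P [set w | [forall i in J, b (X i w)]] = (p ^+ #|J|)%:E.
Proof.
move=> indep mb Pb.
pose Jf : {fset nat} := [fset val i | i in J]%fset.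
have := indep Jf (fun=> [set x | b x]) (fun=> mb).
have -> : \bigcap_(i in [set` Jf]) X i @^-1` [set x | b x] =
    [set w | [forall i in J, b (X i w)]].
  apply/seteqP; split => [w Hw|w /= /forall_inP Hw i /= /imfsetP[j /= jJ ->]].
    apply/forall_inP => i iJ; apply: (Hw (val i)) => /=.
    exact: in_imfset.
  exact: Hw.
move=> ->; rewrite (eq_bigr (fun=> p%:E)); last by move=> i _; exact: Pb.
rewrite big_imfset /=; last by move=> i j _ _; exact: val_inj.
have -> : \big[mule/1%E]_(i <- enum_finmem (mem J)) p%:E =
    (p ^+ size (enum_finmem (mem J)))%:E.
  elim: (enum_finmem _) => [|i s IHs]; first by rewrite big_nil.
  by rewrite big_cons IHs -EFinM exprS.
have /card_uniqP <- := enum_finmem_uniq (mem J).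
by rewrite (eq_card (enum_finmemE _)).
Qed.

(* Independence is assumed for events only; expanding the product
   [\prod_i (1 + (e^t - 1) 1_{A_i})] over subsets suffices to integrate it. *)
Lemma chernoff_le n (b : R -> bool) (p t a : R) :
  mutually_independent X -> measurable [set x | b x] ->
  (forall i, P [set w | b (X i w)] = p%:E) -> 0 <= t ->
  (P [set w | (a <= \sum_(i < n) (b (X i w))%:R)%R] <=
    (expR (- (t * a)) * ((expR t - 1) * p + 1) ^+ n)%:E)%E.
Proof.
move=> indep mb Pb t0.
pose s := expR t - 1.
have s0 : 0 <= s by rewrite subr_ge0 -[leLHS]expR0 ler_expR.
have mbX i : measurable_fun setT (fun w => b (X i w)).
  apply: (measurable_fun_bool true); rewrite setTI.
  have := measurable_funP (X i) measurableT _ mb; rewrite setTI.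
  by congr measurable; apply/seteqP; split => w /=; case: (b _).
pose E (J : {set 'I_n}) := [set w | [forall i in J, b (X i w)]].
have mE J : measurable (E J).
  have -> : E J = \bigcap_(i in [set` J]) [set w | b (X i w)].
    apply/seteqP; split => [w /forall_inP Hw i /= iJ|w Hw]; first exact: Hw.
    by apply/forall_inP => i iJ; exact: Hw.
  apply: fin_bigcap_measurable => [|i _]; first exact: finite_finpred.
  exact: measurable_pred (mbX i).
pose S w := \sum_(i < n) (b (X i w))%:R : R.
have mS : measurable_fun setT S.
  by apply: measurable_sum => i; exact: measurable_natr.
have mA : measurable [set w | a <= S w].
  by apply: measurable_pred; exact: measurable_fun_ler.
set A := [set w | _].
have m1E (B : set T) : measurable B -> measurable_fun setT (fun w => (\1_B w : R)%:E).
  by move=> mB; apply/measurable_EFinP; exact: measurable_indic.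
have m1ZE (r : R) (B : set T) : measurable B ->
    measurable_fun setT (fun w => (r%:E * (\1_B w : R)%:E)%E).
  by move=> mB; apply: emeasurable_funM; [exact: measurable_cst|exact: m1E].
pose Z (J : {set 'I_n}) (w : T) : \bar R := ((s ^+ #|J|)%:E * (\1_(E J) w)%:E)%E.
have mZ J : measurable_fun setT (Z J).
  exact: m1ZE.
have sJ0 (J : {set 'I_n}) : 0 <= s ^+ #|J| by rewrite exprn_ge0.
have Z0 J w : (0 <= Z J w)%E by rewrite mule_ge0// lee_fin.
have H : ((expR (t * a))%:E * P A <= ((s * p + 1) ^+ n)%:E)%E.
  have -> : (P A = \int[P]_w (\1_A w)%:E)%E by rewrite integral_indic// setIT.
  rewrite -ge0_integralZl_EFin ?expR_ge0//; last exact: m1E.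
  apply: (@le_trans _ _ (\int[P]_w (\sum_(J : {set 'I_n}) Z J w))%E).
    apply: ge0_le_integral => //.
    - exact: m1ZE.
    - exact: emeasurable_sum.
    move=> w _.
    have -> : (\sum_(J : {set 'I_n}) Z J w = (\prod_(i < n) (s * (b (X i w))%:R + 1))%:E)%E.
      rewrite prod_1D_natr -sumEFin; apply: eq_bigr => J _.
      by rewrite /Z -EFinM indicE mem_setE.
    rewrite -EFinM lee_fin indicE.
    have [wA|_] := boolP (w \in A); last first.
      by rewrite mulr0 prodr_ge0// => i _; rewrite addr_ge0// mulr_ge0.
    (* Markov's inequality for [exp (t * S)], using [exp (t * b) = (exp t - 1) * b + 1] for [b] in
       [{0, 1}]. *)
    rewrite mulr1; apply: (@le_trans _ _ (expR (t * S w))).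
      by rewrite ler_expR ler_wpM2l//; move: wA; rewrite inE.
    rewrite /S mulr_sumr expR_sum le_eqVlt; apply/orP; left; apply/eqP.
    apply: eq_bigr => i _; rewrite /s; case: (b _).
      by rewrite !mulr1 subrK.
    by rewrite !mulr0 expR0 add0r.
  rewrite ge0_integral_sum//.
  rewrite (eq_bigr (fun J : {set 'I_n} => ((s * p) ^+ #|J|)%:E)); last first.
    move=> J _; rewrite ge0_integralZl_EFin//; last exact: m1E.
    have -> : (\int[P]_w (\1_(E J) w)%:E = (p ^+ #|J|)%:E)%E.
      by rewrite integral_indic// setIT; exact: independent_same_event.
    by rewrite -EFinM exprMn.
  by rewrite sumEFin sum_expr_card.
by rewrite expRN EFinM lee_pdivlMl ?expR_gt0.
Qed.

(** From [exp (- t) >= 1 - t] one gets [exp t <= 1 / (1 - t)], and the quadratic dominates this for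
    [t <= 1/2]. *)
Lemma expR_le_quadratic (t : R) : 0 <= t <= 2^-1 -> expR t <= 1 + t + 2 * t ^+ 2.
Proof.
move=> /andP[t0 t1]; have := expR_ge1Dx (- t); rewrite expRN.
have t2 : 0 < 1 - t by lra.
rewrite -[X in _ -> X <= _]invrK => H.
apply: (@le_trans _ _ (1 - t)^-1).
  by rewrite lef_pV2 ?posrE// invr_gt0 expR_gt0.
rewrite -[leLHS]mul1r ler_pdivrMr//.
have : 0 <= t ^+ 2 * (1 - 2 * t) by rewrite mulr_ge0 ?sqr_ge0//; lra.
by nra.
Qed.

Lemma hoeffding_le n (b : R -> bool) (p e : R) :
  mutually_independent X -> measurable [set x | b x] ->
  (forall i, P [set w | b (X i w)] = p%:E) -> 0 <= p <= 1 -> 0 <= e <= 2 ->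
  (P [set w | (n%:R * (p + e) <= \sum_(i < n) (b (X i w))%:R)%R] <=
    (expR (- (n%:R * e ^+ 2 / 8)))%:E)%E.
Proof.
move=> indep mb Pb /andP[p0 p1] /andP[e0 e2].
(* This minimizes [2 t ^ 2 - t e], the bound on the exponent per observation, with minimum
   [- e ^ 2 / 8]; [e <= 2] ensures [t <= 1/2]. *)
pose t := e / 4; have t0 : 0 <= t by rewrite /t; lra.
apply: (le_trans (chernoff_le n _ indep mb Pb t0)); rewrite lee_fin.
have t2 : expR t <= 1 + t + 2 * t ^+ 2.
  by apply: expR_le_quadratic; apply/andP; split; rewrite /t; lra.
have q0 : 0 <= (expR t - 1) * p.
  by rewrite mulr_ge0// subr_ge0 -[leLHS]expR0 ler_expR.
apply: (@le_trans _ _ (expR (- (t * (n%:R * (p + e)))) * expR (n%:R * ((expR t - 1) * p)))).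
  rewrite ler_wpM2l ?expR_ge0// expRM_natl; apply: lerXn2r.
  - by rewrite nnegrE addr_ge0.
  - by rewrite nnegrE expR_ge0.
  - by rewrite addrC; exact: expR_ge1Dx.
rewrite -expRD ler_expR.
have -> : - (t * (n%:R * (p + e))) + n%:R * ((expR t - 1) * p) =
  n%:R * ((expR t - 1 - t) * p - t * e) by ring.
have -> : - (n%:R * e ^+ 2 / 8) = n%:R * (- (e ^+ 2 / 8)) by ring.
rewrite ler_wpM2l//.
have : (expR t - 1 - t) * p <= 2 * t ^+ 2 * 1.
  have [E0|E0] := leP 0 (expR t - 1 - t).
    by apply: ler_pM => //; lra.
  apply: (@le_trans _ _ 0); first by rewrite mulr_le0_ge0// ltW.
  by rewrite mulr1 mulr_ge0// sqr_ge0.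
by rewrite /t => H; nra.
Qed.

End Chernoff.

(** * Almost sure uniform rate for the empirical distribution function *)

Section UniformConvergence.
Context (disp : measure_display) (T : measurableType disp) (R : realType).
Variables (P : probability T R) (X : nat -> {RV P >-> R}) (f : R -> R).
Local Notation mu := (@lebesgue_measure R).
Local Notation F := (kernel_cdf f).
Hypotheses (indep : mutually_independent X)
  (dens : forall i, has_density (X i) f) (Lf : L1 f).

Let f0 x : 0 <= f x. Proof. by have [_ ] := dens 0%N. Qed.

Lemma density_Rint : \int[mu]_x f x = 1.
Proof.
have [_ _ /(_ setT measurableT)] := dens 0%N.
rewrite /distribution /pushforward preimage_setT probability_setT -(Rint_EFin Lf).
by move=> H; apply: EFin_inj; rewrite -H.
Qed.

Lemma density_cdf i x : P [set w | X i w <= x] = (F x)%:E.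
Proof.
have [_ _ /(_ [set` `]-oo, x]] (measurable_itv _))] := dens i.
rewrite /distribution /pushforward (_ : X i @^-1` _ = [set w | X i w <= x]); last first.
  by apply/seteqP; split => w /=; rewrite in_itv.
move=> ->; rewrite fineK//; apply: integrable_fin_num => //.
exact: integrableS Lf.
Qed.

Let mleX (x : R) i : measurable_fun setT (fun w => X i w <= x).
Proof. by apply: measurable_fun_ler => //; exact: measurable_funP. Qed.

Let mgtX (x : R) i : measurable_fun setT (fun w => x < X i w).
Proof. by apply: measurable_fun_ltr => //; exact: measurable_funP. Qed.

Lemma density_cdfC i x : P [set w | x < X i w] = (1 - F x)%:E.
Proof.
rewrite (_ : [set w | x < X i w] = ~` [set w | X i w <= x]); last first.
  apply/seteqP; split => w /=; first by rewrite leNgt => ->.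
  by move/negP; rewrite -ltNge.
by rewrite probability_setC ?density_cdf//; exact: measurable_pred (mleX x i).
Qed.

Lemma density_cdf_itv x : 0 <= F x <= 1.
Proof.
have H := density_cdf 0 x.
have h0 : (0 <= (F x)%:E)%E by rewrite -H; exact: measure_ge0.
have h1 : ((F x)%:E <= 1%:E)%E.
  by rewrite -H; exact: probability_le1 (measurable_pred (mleX x 0)).
by move: h0 h1; rewrite !lee_fin => -> ->.
Qed.

Lemma density_cdf_homo x y : x <= y -> F x <= F y.
Proof.
move=> xy; rewrite -subr_ge0 (kernel_cdf_sub Lf xy).
by apply: Rintegral_ge0 => t _; rewrite mulr_ge0.
Qed.

Lemma density_quantile q : 0 < q < 1 -> exists x, F x = q.
Proof.
move=> /andP[q0 q1].
have [|M M0 HM] := kernel_cdf_Noo Lf (e := q); first by [].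
have [|N N0 HN] := kernel_cdf_oo Lf (e := 1 - q); first by rewrite subr_gt0.
have ab : - M - 1 <= N + 1 by lra.
have := HM (- M - 1) _; have := HN (N + 1) _; rewrite density_Rint => H1 H2.
have {}H1 : q <= F (N + 1).
  have /ler_normlP[_] : `|1 - F (N + 1)| <= 1 - q by apply: H1; lra.
  by lra.
have {}H2 : F (- M - 1) <= q.
  have /ler_normlP[_] : `|F (- M - 1)| <= q by apply: H2; lra.
  by [].
have [||c _ Fc] := @IVT R F (- M - 1) (N + 1) q ab; last by exists c.
- exact/continuous_subspaceT/kernel_cdf_continuous.
- by rewrite ge_min H2 le_max H1 orbT.
Qed.

(* The slack is [2 / n] rather than [1 / n] because [Num.truncn (n F x) / n] may
   equal [F x], in which case the next lower grid point is used. *)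
Lemma grid_approximation (Fn : R -> R) (Q : R -> R) (e : R) n : (0 < n)%N ->
  0 <= e -> (forall q, 0 < q < 1 -> F (Q q) = q) ->
  (forall x, 0 <= Fn x <= 1) -> {homo Fn : x y / x <= y} ->
  (forall j, (0 < j < n)%N -> `|Fn (Q (j%:R / n%:R)) - F (Q (j%:R / n%:R))| <= e) ->
  forall x, `|Fn x - F x| <= e + 2 / n%:R.
Proof.
move=> n0 e0 FQ Fn01 Fnh He x.
have nR : (0 : R) < n%:R by rewrite ltr0n.
have /andP[p0 p1] := density_cdf_itv x.
have /andP[Fn0 Fn1] := Fn01 x.
pose m := Num.truncn (n%:R * F x).
have /andP[m1 m2] : m%:R <= n%:R * F x < m.+1%:R.
  by apply: Num.Theory.truncn_itv; rewrite mulr_ge0.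
have FxQ (j : nat) : (0 < j < n)%N -> F (Q (j%:R / n%:R)) = j%:R / n%:R.
  move=> /andP[j0 jn]; apply: FQ.
  by rewrite divr_gt0 ?ltr0n//= ltr_pdivrMr// mul1r ltr_nat.
have n1 : 1 / n%:R = n%:R^-1 :> R by rewrite div1r.
have ninv : 0 < n%:R^-1 :> R by rewrite invr_gt0.
apply/ler_normlP; split.
  rewrite opprB lerBlDr.
  (* There may be no grid point below, but then [F x] itself is within the slack. *)
  have [m2'|m2'] := leqP m 1%N.
    have : F x <= 2 / n%:R.
      rewrite ler_pdivlMr// mulrC; apply: (le_trans (ltW m2)).
      by rewrite ler_nat ltnS.
    by lra.
  have jn : (0 < m.-1 < n)%N.
    case: m m1 m2 m2' => [|[|m]] //= m1 _ _.
    have : m.+2%:R <= n%:R :> R by apply: (le_trans m1); rewrite ler_piMr// ltW.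
    by rewrite ler_nat.
  have Fy := FxQ _ jn; have := He _ jn; rewrite Fy.
  set y := Q _ in Fy *; move/ler_normlP => [+ _]; rewrite opprB lerBlDr => H.
  have yx : y <= x.
    rewrite leNgt; apply/negP => /ltW /density_cdf_homo; rewrite Fy leNgt => /negP; apply.
    rewrite ltr_pdivrMr// [F x * _]mulrC; apply: lt_le_trans m1.
    by rewrite ltr_nat; case: (m) m2'.
  have Hm : F x <= m.-1%:R / n%:R + 2 / n%:R.
    rewrite -mulrDl ler_pdivlMr// mulrC; apply: (le_trans (ltW m2)).
    by rewrite -natrD ler_nat; case: (m) m2' => //= k _; rewrite addn2.
  by have := Fnh _ _ yx; lra.
rewrite lerBlDr.
(* If no grid point lies above, then [F x >= 1 - 1 / n] and the trivial bound [Fn x <= 1]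
   suffices. *)
have [jn|mn] := ltnP m.+1 n; last first.
  have : 1 - n%:R^-1 <= F x.
    rewrite -n1 lerBlDr -[X in X <= _](@divff _ (n%:R : R)) ?gt_eqF//.
    rewrite ler_pdivrMr// mulrDl div1r mulVf ?gt_eqF// mulrC.
    apply: (@le_trans _ _ (m.+1%:R)); first by rewrite ler_nat.
    by rewrite -natr1 lerD2r.
  by lra.
have jn' : (0 < m.+1 < n)%N by rewrite jn.
have Fy := FxQ _ jn'; have := He _ jn'; rewrite Fy.
set y := Q _ in Fy *; move/ler_normlP => [_]; rewrite lerBlDr => H.
have xy : x <= y.
  rewrite leNgt; apply/negP => /ltW /density_cdf_homo; rewrite Fy leNgt => /negP; apply.
  by rewrite ltr_pdivlMr// mulrC.
have Hm : m.+1%:R / n%:R <= F x + n%:R^-1.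
  rewrite ler_pdivrMr// mulrDl mulVf ?gt_eqF// -natr1 lerD2r.
  by rewrite mulrC.
by have := Fnh _ _ xy; lra.
Qed.

Lemma empirical_cdf_itv (x : nat -> R) n t : 0 <= empirical_cdf x n t <= 1.
Proof.
rewrite /empirical_cdf; case: n => [|n]; first by rewrite big_ord0 mulr0 lexx ler01.
have n0 : (0 : R) < n.+1%:R by rewrite ltr0n.
apply/andP; split; first by rewrite mulr_ge0 ?invr_ge0 ?(ltW n0)//; exact: sumr_ge0.
rewrite mulrC ler_pdivrMr// mul1r.
have E : n.+1%:R = \sum_(i < n.+1) 1 :> R by rewrite sumr_const card_ord.
rewrite [leRHS]E; apply: ler_sum => i _.
by rewrite -[leRHS]/(true%:R) ler_nat leq_b1.
Qed.

Lemma empirical_cdf_homo (x : nat -> R) n : {homo empirical_cdf x n : s t / s <= t}.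
Proof.
move=> s t st; rewrite /empirical_cdf ler_wpM2l ?invr_ge0//.
apply: ler_sum => i _; rewrite ler_nat.
by have [xs|] := leP (x i) s; rewrite ?(le_trans xs st).
Qed.

(** Uses [exp y >= y ^ (k + 1) / (k + 1)!] with [b (k + 1) >= 3]. Cubic decay pays for the [n] grid
    points and still leaves the summable [n ^ -2]. *)
Lemma expRN_powR_le (b : R) : 0 < b -> exists2 C, 0 <= C &
  forall n, (0 < n)%N -> expR (- (n%:R `^ b / 8)) <= C * n%:R ^- 3.
Proof.
move=> b0; pose k := Num.truncn (3 / b).
have kb : 3 <= b * k.+1%:R.
  rewrite mulrC -ler_pdivrMr// ltW//.
  by have /andP[] : k%:R <= 3 / b < k.+1%:R by apply: Num.Theory.truncn_itv; rewrite divr_ge0// ltW.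
pose a : R := 8 ^+ k.+1; have a0 : 0 < a by rewrite exprn_gt0.
have fact0 : (0 : R) < k.+1`!%:R by rewrite ltr0n fact_gt0.
have af0 : 0 < a * k.+1`!%:R by rewrite mulr_gt0.
exists (a * k.+1`!%:R) => [|n n0]; first exact: ltW.
have nR : (0 : R) < n%:R by rewrite ltr0n.
have n1 : (1 : R) <= n%:R by rewrite ler1n.
rewrite expRN invf_ple ?posrE ?expR_gt0//; last first.
  by rewrite mulr_gt0// invr_gt0 exprn_gt0.
have y0 : 0 <= n%:R `^ b / 8 by rewrite divr_ge0// powR_ge0.
apply: le_trans (expR_ge1Dxn k y0).
apply: (@le_trans _ _ ((n%:R `^ b / 8) ^+ k.+1 / k.+1`!%:R)); last by rewrite lerDr.
have -> : (n%:R `^ b / 8) ^+ k.+1 / k.+1`!%:R = (n%:R `^ b) ^+ k.+1 / (a * k.+1`!%:R).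
  by rewrite exprMn exprVn -/a [in RHS]invfM mulrA.
rewrite invfM invrK mulrC ler_wpM2r//; first by rewrite invr_ge0 ltW.
rewrite -(powR_mulrn 3 (ltW nR)) -(powR_mulrn k.+1 (powR_ge0 _ _)) -powRrM.
exact: ler_powR.
Qed.

(** With threshold [n ^ -s], Hoeffding's exponent is [- n ^ (1 - 2 s) / 8]. For [s < 1/2] this beats
    the number of grid points, which may therefore be as large as [n], so that the grid itself costs
    only [2 / n]. *)
Lemma empirical_cdf_uniform_rate (s : R) : 0 < s < 2^-1 ->
  {ae P, forall w, \forall n \near \oo, forall x,
    `|empirical_cdf (fun i => X i w) n x - F x| <= n%:R `^ (- s) + 2 / n%:R}.
Proof.
move=> /andP[s0 s1].
have /choice[Q HQ] : forall q, exists x, 0 < q < 1 -> F x = q.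
  move=> q; have [q01|_] := boolP (0 < q < 1); last by exists 0.
  by have [x Fx] := density_quantile q01; exists x.
pose e (n : nat) : R := n%:R `^ (- s).
have e0 n : 0 <= e n by exact: powR_ge0.
pose y (n j : nat) := Q (j%:R / n%:R).
pose U n j := [set w | n%:R * (F (y n j) + e n) <= \sum_(i < n) (X i w <= y n j)%R%:R].
(* A lower deviation of [F_n] is an upper deviation for the complementary event, so the one-sided
   inequality serves twice. *)
pose V n j := [set w | n%:R * ((1 - F (y n j)) + e n) <= \sum_(i < n) (y n j < X i w)%R%:R].
have mU n j : measurable (U n j).
  apply: measurable_pred; apply: measurable_fun_ler => //.
  by apply: measurable_sum => i; exact: measurable_natr (mleX _ _).
have mV n j : measurable (V n j).
  apply: measurable_pred; apply: measurable_fun_ler => //.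
  by apply: measurable_sum => i; exact: measurable_natr (mgtX _ _).
have mle (x : R) : measurable [set t : R | t <= x].
  rewrite (_ : [set t : R | t <= x] = [set` `]-oo, x]]); first exact: measurable_itv.
  by apply/seteqP; split => t /=; rewrite in_itv.
have mgt (x : R) : measurable [set t : R | x < t].
  rewrite (_ : [set t : R | x < t] = [set` `]x, +oo[]); first exact: measurable_itv.
  by apply/seteqP; split => t /=; rewrite in_itv /= andbT.
pose bad n := \big[setU/set0]_(j < n) (U n j `|` V n j).
have mbad n : measurable (bad n).
  by apply: bigsetU_measurable => j _; exact: measurableU.
have e2 n : (0 < n)%N -> 0 <= e n <= 2.
  move=> n0; rewrite e0/= /e powRN; apply: (@le_trans _ _ 1); last by lra.
  rewrite invf_ple ?posrE ?powR_gt0 ?ltr0n// invr1.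
  rewrite -[leLHS](powRr0 n%:R); apply: ler_powR; last exact: ltW.
  by rewrite ler1n.
pose u n : R := n%:R * (2 * expR (- (n%:R * e n ^+ 2 / 8))).
have Pbad n : (0 < n)%N -> (P (bad n) <= (u n)%:E)%E.
  move=> n0; apply: (le_trans (Boole_inequality P (A := fun j => U n j `|` V n j) (n := n) _)).
    by move=> i _; exact: measurableU.
  apply: (@le_trans _ _ (\sum_(j < n) (2 * expR (- (n%:R * e n ^+ 2 / 8)))%:E)%E); last first.
    by rewrite sumEFin sumr_const card_ord lee_fin -[leLHS]mulr_natl.
  apply: lee_sum => j _; apply: (le_trans (measureU2 P (mU n j) (mV n j))).
  rewrite mulrDl mul1r EFinD; apply: leeD.
    exact: (hoeffding_le n indep (mle (y n j)) (fun i => density_cdf i (y n j))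
      (density_cdf_itv (y n j)) (e2 n n0)).
  have F01 : 0 <= 1 - F (y n j) <= 1.
    by have /andP[? ?] := density_cdf_itv (y n j); apply/andP; split; lra.
  exact: (hoeffding_le n indep (mgt (y n j)) (fun i => density_cdfC i (y n j))
    F01 (e2 n n0)).
have b0 : 0 < 1 - 2 * s by lra.
have [C C0 HC] := expRN_powR_le b0.
(* Summability by telescoping: [n ^ -2 <= 2 / (n (n + 1))]. *)
have uC n : (0 < n)%N -> u n <= 4 * C * (n%:R^-1 - n.+1%:R^-1).
  move=> n0; have nR : (0 : R) < n%:R by rewrite ltr0n.
  have n1 : (1 : R) <= n%:R by rewrite ler1n.
  have -> : n%:R^-1 - n.+1%:R^-1 = (n%:R * n.+1%:R)^-1 :> R.
    by rewrite -natr1; field; rewrite !gt_eqF ?addr_gt0.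
  have ne : n%:R * e n ^+ 2 = n%:R `^ (1 - 2 * s).
    rewrite powRB; last by apply/implyP => _; rewrite gt_eqF.
    rewrite powRr1 ?ltW// mulrC [2 * s]mulrC powRrM powR_mulrn ?powR_ge0//.
    by rewrite /e powRN exprVn mulrC.
  rewrite /u ne; apply: (@le_trans _ _ (n%:R * (2 * (C * n%:R ^- 3)))).
    by rewrite !ler_wpM2l// HC.
  have -> : n%:R * (2 * (C * n%:R ^- 3)) = 2 * C * n%:R ^- 2 :> R.
    by field; rewrite gt_eqF.
  have -> : 4 * C * (n%:R * n.+1%:R)^-1 = 2 * C * (2 / (n%:R * n.+1%:R)) by ring.
  rewrite ler_wpM2l ?mulr_ge0//.
  rewrite ler_pdivlMr ?mulr_gt0// mulrC ler_pdivrMr ?exprn_gt0//.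
  by rewrite expr2 -natr1; nra.
have S N : (\sum_(0 <= i < N.+1) P (bad i) <= (4 * C * (1 - N.+1%:R^-1))%:E)%E.
  elim: N => [|N IH].
    by rewrite big_nat1 /bad big_ord0 measure0 invr1 subrr mulr0.
  rewrite big_nat_recr//=; apply: (le_trans (leeD IH (Pbad N.+1 isT))).
  rewrite -EFinD lee_fin; apply: (le_trans (lerD (lexx _) (uC N.+1 isT))).
  by rewrite -mulrDr addrA subrK.
have Sfin : (\sum_(n <oo) P (bad n) < +oo)%E.
  apply: (@le_lt_trans _ _ (4 * C)%:E); last by rewrite ltry.
  apply: lime_le; first by apply: is_cvg_nneseries => n _ _.
  near=> n; have n0 : (0 < n)%N by near: n; exact: nbhs_infty_gt.
  rewrite -(prednK n0); apply: (le_trans (S n.-1)); rewrite lee_fin.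
  rewrite -[leRHS]mulr1 ler_wpM2l//; by rewrite mulr_ge0.

(* Borel-Cantelli: the exceptional set consists of the outcomes that are bad for infinitely many
   [n]. *)
exists (lim_sup_set bad); split.
- by apply: bigcap_measurable => // n _; exact: bigcup_measurable.
- exact: lim_sup_set_cvg0.
- move=> w /= Hw; apply: contrapT => Hnot; apply: Hw.
  have [N HN] : exists N, forall n, (N <= n)%N -> ~ bad n w.
    apply: contrapT => /forallNP H; apply: Hnot => N _.
    by have /existsNP[n /not_implyP[Nn /contrapT bn]] := H N; exists n.
  near=> n => x.
  have n0 : (0 < n)%N by near: n; exact: nbhs_infty_gt.
  have Nn : (N <= n)%N by near: n; exact: nbhs_infty_ge.
  have nR : (0 : R) < n%:R by rewrite ltr0n.
  have nbad := HN n Nn.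
  apply: (@grid_approximation (empirical_cdf (fun i => X i w) n) Q (e n) n n0 (e0 n) HQ).
  - exact: empirical_cdf_itv.
  - exact: empirical_cdf_homo.
  move=> j /andP[j0 jn]; rewrite -/(y n j).
  have [nU nV] : ~ U n j w /\ ~ V n j w.
    split => H; apply: nbad; rewrite /bad (bigD1 (Ordinal jn))//=; left; [by left|by right].
  have {nU} : \sum_(i < n) (X i w <= y n j)%R%:R < n%:R * (F (y n j) + e n).
    by rewrite ltNge; apply/negP.
  have {nV} : \sum_(i < n) (y n j < X i w)%R%:R < n%:R * ((1 - F (y n j)) + e n).
    by rewrite ltNge; apply/negP.
  have -> : \sum_(i < n) (y n j < X i w)%R%:R = n%:R - \sum_(i < n) (X i w <= y n j)%R%:R :> R.
    have E : n%:R = \sum_(i < n) 1 :> R by rewrite sumr_const card_ord.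
    rewrite E -sumrB; apply: eq_bigr => i _.
    by case: ltP; rewrite ?subr0 ?subrr.
  rewrite /empirical_cdf; set S' := \sum_(i < n) _ => H1 H2.
  have H2' : S' < n%:R * (F (y n j) + e n) by [].
  have H1' : n%:R * (F (y n j) - e n) < S' by move: H1; lra.
  apply/ltW; rewrite ltr_norml mulrC; apply/andP; split.
    by rewrite ltrBrDr addrC ltr_pdivlMr// mulrC.
  by rewrite ltrBlDr addrC ltr_pdivrMr// mulrC.
Unshelve. all: by end_near. Qed.

End UniformConvergence.

(** * Conclusion *)

Section SmoothedEmpirical.
Variable R : realType.
Local Notation mu := (@lebesgue_measure R).
Implicit Types (K f : R -> R).

(** The condition [u <= (t - x_i) / h] is [x_i <= t - h u], so each summand is the integral of an
    empirical indicator against [K]. *)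
Lemma smoothed_cdfE K (x : nat -> R) n (h t : R) : L1 K -> 0 < h ->
  smoothed_cdf K x n h t = smoothing K (empirical_cdf x n) h t.
Proof.
move=> LK h0; rewrite /smoothed_cdf /smoothing.
have Li (i : 'I_n) : L1 (fun u => (u <= (t - x i) / h)%R%:R * K u).
  exact: L1_indicM (measurable_le _) LK.
transitivity (\int[mu]_u (n%:R^-1 * \sum_(i < n) (u <= (t - x i) / h)%R%:R * K u)).
  rewrite (RintZl _ (L1_sum _ Li)) (Rint_sum _ Li); congr (_ * _).
  by apply: eq_bigr => i _; rewrite kernel_cdfE.
apply: eq_Rintegral => u _; rewrite /empirical_cdf -mulrA mulr_suml; congr (_ * _).
apply: eq_bigr => i _; congr (_%:R * _).
by rewrite ler_pdivlMr// lerBrDr addrC -lerBrDr mulrC.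
Qed.

Lemma L1_smoothing_empirical K (x : nat -> R) n (h t : R) : L1 K ->
  L1 (fun u => empirical_cdf x n (t - h * u) * K u).
Proof.
move=> LK; apply: (L1_bddM (C := 1) _ _ LK) => [|u]; last first.
  by have /andP[e0 e1] := empirical_cdf_itv x n (t - h * u); rewrite ger0_norm.
apply: measurable_funM => //; apply: measurable_sum => i.
apply: measurable_natr; apply: measurable_fun_ler => //.
by apply: measurable_funB => //; exact: measurable_funM.
Qed.

(** Smoothing multiplies the sup norm by at most the integral of [|K|], whatever [h] is; this lets
    [h] depend on the sample. *)
Lemma smoothing_diff_le K f (x : nat -> R) n (h r : R) : L1 K -> L1 f ->
  (forall t, `|empirical_cdf x n t - kernel_cdf f t| <= r) ->
  forall t, `|(empirical_cdf x n t - smoothing K (empirical_cdf x n) h t) -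
    (kernel_cdf f t - smoothing K (kernel_cdf f) h t)| <=
    (1 + \int[mu]_u `|K u|) * r.
Proof.
move=> LK Lf Hr t.
have Le := L1_smoothing_empirical x n h t LK.
have LF := L1_smoothing LK Lf h t.
have -> : (empirical_cdf x n t - smoothing K (empirical_cdf x n) h t) -
    (kernel_cdf f t - smoothing K (kernel_cdf f) h t) =
  (empirical_cdf x n t - kernel_cdf f t) -
    (smoothing K (empirical_cdf x n) h t - smoothing K (kernel_cdf f) h t) by ring.
apply: (le_trans (ler_normB _ _)); rewrite mulrDl mul1r; apply: lerD => //.
rewrite -(RintB Le LF) mulrC -(RintZl _ (L1_norm LK)).
apply: Rint_le_norm (L1B Le LF) (L1Zl _ (L1_norm LK)) _ => u.
by rewrite -mulrBl normrM ler_wpM2r.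
Qed.

(** Makes the last clause of [sup_like] applicable to the error. For [|u| <= M] the point [x - h u]
    stays far to the left; the rest is the tail of [K]. *)
Lemma smoothing_vanishes K f (h : R) : L1 K -> L1 f -> 0 < h ->
  vanishes_at_Noo (fun x => kernel_cdf f x - smoothing K (kernel_cdf f) h x).
Proof.
move=> LK Lf h0 e e0.
pose B := \int[mu]_t `|f t|; pose k := \int[mu]_u `|K u|.
have B0 : 0 <= B by apply: Rintegral_ge0.
have k0 : 0 <= k by apply: Rintegral_ge0.
have e3 : 0 < e / 3 by rewrite divr_gt0.
have ek : 0 < e / 3 / (k + 1) by rewrite divr_gt0// ltr_wpDl.
have eB : 0 < e / 3 / (B + 1) by rewrite divr_gt0// ltr_wpDl.
have [M1 M10 HM1] := kernel_cdf_Noo Lf e3.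
have [M2 M20 HM2] := kernel_cdf_Noo Lf ek.
have [M M0 HM] := L1_tail LK eB.
have hM : 0 < h * M by rewrite mulr_gt0.
exists (M1 + M2 + h * M) => [|x xM]; first by rewrite !addr_gt0.
apply: (le_trans (ler_normB _ _)).
have F1 : `|kernel_cdf f x| <= e / 3 by apply: HM1; lra.
have mM : measurable_fun setT (fun u : R => M < `|u|).
  by apply: measurable_fun_ltr => //; exact: measurableT_comp.
have La := L1Zl (e / 3 / (k + 1)) (L1_norm LK).
have Lb := L1Zl B (L1_indicM mM (L1_norm LK)).
have S1 : `|smoothing K (kernel_cdf f) h x| <= e / 3 / (k + 1) * k + B * (e / 3 / (B + 1)).
  apply: (@le_trans _ _ (\int[mu]_u (e / 3 / (k + 1) * `|K u| + B * ((M < `|u|)%R%:R * `|K u|)))).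
    apply: Rint_le_norm (L1_smoothing LK Lf h x) (L1D La Lb) _ => u.
    rewrite normrM; have [uM|Mu] := leP `|u| M.
      rewrite mul0r mulr0 addr0 ler_wpM2r//; apply: HM2.
      have : - (h * M) <= h * u.
        by rewrite -mulrN ler_wpM2l ?(ltW h0)//; move: uM; rewrite ler_norml => /andP[].
      by lra.
    rewrite mul1r; apply: (@le_trans _ _ (B * `|K u|)).
      by rewrite ler_wpM2r//; exact: kernel_cdf_le.
    by rewrite lerDr mulr_ge0// ltW.
  rewrite (RintD La Lb) (RintZl _ (L1_norm LK)) (RintZl _ (L1_indicM mM (L1_norm LK))).
  by rewrite lerD2l ler_wpM2l.
have E1 : e / 3 / (k + 1) * k <= e / 3.
  by rewrite mulrAC ler_pdivrMr ?ltr_wpDl// ler_wpM2l ?(ltW e3)// lerDl.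
have E2 : B * (e / 3 / (B + 1)) <= e / 3.
  by rewrite mulrA ler_pdivrMr ?ltr_wpDl// mulrC ler_wpM2l ?(ltW e3)// lerDl.
by lra.
Qed.

(** If the last antiderivative vanished, each earlier one would be constant and tend to [0] at
    [-oo], hence vanish too, down to the first, whose limit at [+oo] is nonzero. *)
Lemma primitive_chain_neq0 ell (v : nat -> R -> R) :
  (forall j, (j <= ell)%N -> L1 (v j)) ->
  (forall j, (j < ell)%N -> forall x : R,
     is_derive x (1 : R) (kernel_cdf (v j)) (kernel_cdf (v j.+1) x)) ->
  \int[mu]_x v 0%N x != 0 -> exists x, kernel_cdf (v ell) x != 0.
Proof.
move=> Lv dv; apply: contra_neqP => /forallNP v0.
have G0 j : (j <= ell)%N -> forall x, kernel_cdf (v (ell - j)%N) x = 0.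
  elim: j => [_ x|j IH jl x].
    by rewrite subn0; apply/eqP; apply: contrapT => /negP; exact: v0.
  have lj : (ell - j.+1 < ell)%N by rewrite ltn_subrL /= (leq_trans _ jl).
  have Lj := Lv _ (ltnW lj).
  have dj z : is_derive z (1 : R) (kernel_cdf (v (ell - j.+1)%N)) 0.
    by have := dv _ lj z; rewrite (subnSK jl) (IH (ltnW jl)).
  apply/eqP; rewrite -normr_le0; apply/ler_addgt0Pl => e e0; rewrite addr0.
  have [M M0 HM] := kernel_cdf_Noo Lj e0.
  rewrite (is_derive_0_is_cst (f := kernel_cdf (v (ell - j.+1)%N)) x (- M - 1))//.
  by apply: HM; lra.
apply/eqP; rewrite -normr_le0; apply/ler_addgt0Pl => e e0; rewrite addr0.
have [M M0 HM] := kernel_cdf_oo (Lv 0%N (leq0n _)) e0.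
have := HM (M + 1) _; have := G0 ell (leqnn _); rewrite subnn => ->.
by rewrite subr0; apply; lra.
Qed.

Lemma rate_negligible (gamma s e : R) : 0 < gamma -> gamma < s -> s < 1 -> 0 < e ->
  \forall n \near \oo, n%:R `^ (- s) + 2 / n%:R <= e * n%:R `^ (- gamma).
Proof.
move=> g0 gs s1 e0; near=> n.
have n0 : (0 : R) < n%:R by rewrite ltr0n; near: n; exact: nbhs_infty_gt.
have nn0 : n%:R != 0 :> R by rewrite gt_eqF.
have pg : 0 < n%:R `^ (- gamma) by exact: powR_gt0.
have -> : n%:R `^ (- s) = n%:R `^ (- (s - gamma)) * n%:R `^ (- gamma).
  by rewrite -powRD ?nn0 ?implybT//; congr (_ `^ _); ring.
have -> : n%:R^-1 = n%:R `^ (- (1 - gamma)) * n%:R `^ (- gamma).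
  rewrite -powRD ?nn0 ?implybT// (_ : _ + _ = - 1); first by rewrite powR_inv1// ltW.
  by ring.
have A1 : n%:R `^ (- (s - gamma)) <= e / 2.
  by near: n; apply: powRN_cvg0; rewrite ?divr_gt0 ?subr_gt0.
have A2 : n%:R `^ (- (1 - gamma)) <= e / 4.
  by near: n; apply: powRN_cvg0; rewrite ?divr_gt0 ?subr_gt0// (lt_trans gs).
rewrite mulrA -mulrDl ler_wpM2r ?(ltW pg)//.
by lra.
Unshelve. all: by end_near. Qed.

End SmoothedEmpirical.

Theorem theorem3p3 (disp : measure_display) (T : measurableType disp)
    (R : realType) (P : probability T R)
    (ell : nat) (K : R -> R) (X : nat -> {RV P >-> R}) (f : R -> R)
    (d : (R -> R) -> (R -> R) -> \bar R) (c gamma : R) (h : nat -> T -> R) :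
  (2 <= ell)%N ->
  kernel_of_order ell K ->
  mutually_independent X ->
  (forall i, has_density (X i) f) ->
  sobolev1 ell f ->
  d = @dist_sup R \/ (exists2 k, (1 <= k)%N & d = @dist_kuiper R k) ->
  0 < c ->
  0 < gamma < 2^-1 ->
  {ae P, forall w, \forall n \near \oo,
    0 < h n w /\
    d (empirical_cdf (fun i => X i w) n)
      (smoothed_cdf K (fun i => X i w) n (h n w))
    = (c * n%:R `^ (- gamma))%:E} ->
  {ae P, forall w, exists2 e : nat -> R, e @ \oo --> (0 : R) &
    \forall n \near \oo,
      h n w =
      (c * ell`!%:R /
        (`|kernel_moment K ell|
         * fine (d (continuous_weak_derivative (ell - 1) f) (fun=> 0))))
        `^ ell%:R^-1
      * n%:R `^ (- (gamma / ell%:R)) * (1 + e n)}.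
Proof.
move=> l2 kK indep dens sf Hd c0 /andP[g0 g1] hyp.
have l0 : (0 < ell)%N by apply: leq_trans l2.
have Lf : L1 f by case: sf.
have LK : L1 K.
  have [/(_ 0%N (leq0n _)) LK _ _ _] := kK.
  by move: LK; congr L1; apply/funext => u; rewrite expr0 mul1r.
have k0 : kernel_moment K ell != 0 by case: kK.
have [L dL] : exists L, sup_like d L.
  by case: Hd => [->|[k k1 ->]]; [exists 1; exact: sup_like_dist_sup|
    exists (2 * k%:R); exact: sup_like_dist_kuiper].
have [v v0 [Lv dv wv]] := sobolev1_primitives sf.
have cg : continuous (kernel_cdf (v ell)) by exact/kernel_cdf_continuous/Lv.
rewrite (continuous_weak_derivativeE cg (wv l0)).
set g := kernel_cdf (v ell).
have f1 := density_Rint dens Lf.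
have f0 x : 0 <= f x by have [_ ] := dens 0%N.
pose B := \int[@lebesgue_measure R]_x `|v 0%N x| + \int[@lebesgue_measure R]_x `|v ell x|.
have B0 x : `|kernel_cdf (v 0%N) x| <= B.
  by apply: (le_trans (kernel_cdf_le x (Lv 0%N (leq0n _)))); rewrite lerDl; apply: Rintegral_ge0.
have Bg x : `|g x| <= B.
  by apply: (le_trans (kernel_cdf_le x (Lv ell (leqnn _)))); rewrite lerDr; apply: Rintegral_ge0.
have [x0 gx0] : exists x, g x != 0.
  by apply: primitive_chain_neq0 => //; rewrite v0 f1 oner_neq0.
pose kappa := kernel_moment K ell / ell`!%:R.
have fact0 : (ell`!%:R : R) != 0 by rewrite pnatr_eq0 -lt0n fact_gt0.
have kap0 : kappa != 0 by rewrite mulf_neq0// invr_eq0.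
pose D s x := kernel_cdf f x - smoothing K (kernel_cdf f) s x.
have H3 e : 0 < e -> exists2 t0, 0 < t0 & forall t, 0 < t <= t0 -> forall x,
    `|D t x + (- t) ^+ ell * kappa * g x| <= e * t ^+ ell.
  move=> e0; have ucg e' : 0 < e' -> exists2 d, 0 < d & forall x y, `|x - y| < d ->
      `|kernel_cdf (v ell) x - kernel_cdf (v ell) y| <= e'.
    by move=> e'0; exact: kernel_cdf_unif_cont (Lv _ (leqnn _)) e'0.
  have [t0 t00 Ht] := smoothing_expansion (G := fun j => kernel_cdf (v j)) l0 kK dv B0 Bg ucg e0.
  exists t0 => // t tt0 x; have := Ht t tt0 x.
  by rewrite v0 -/(D t x) mulrA.
have H1 := smoothing_error_lower_bound LK Lf f0 f1 cg Bg kap0 gx0 H3.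
have H2 s : 0 < s -> vanishes_at_Noo (D s) by exact: smoothing_vanishes.
have vg : vanishes_at_Noo g by move=> e e0; exact: kernel_cdf_Noo (Lv _ (leqnn _)) e0.
(* The midpoint of [gamma] and [1/2]: below [1/2] for the uniform rate to hold, above [gamma] for
   [n ^ -s] to be negligible against [n ^ -gamma]. *)
pose s := (gamma + 2^-1) / 2.
have s01 : 0 < s < 2^-1 by apply/andP; split; rewrite /s; lra.
have unif := empirical_cdf_uniform_rate indep dens Lf s01.
(* From here on the sample path is fixed. *)
apply: filterS2 hyp unif => w hw uw.
pose C := 1 + \int[@lebesgue_measure R]_u `|K u|.
have C0 : 0 <= C by rewrite addr_ge0//; apply: Rintegral_ge0.
have Hr e : 0 < e -> \forall n \near \oo, n%:R `^ (- s) + 2 / n%:R <= e * n%:R `^ (- gamma).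
  by move=> e0; apply: rate_negligible => //; rewrite /s; lra.
have -> : c * ell`!%:R / (`|kernel_moment K ell| * fine (d g (fun=> 0))) =
    c / (`|kappa| * fine (d g (fun=> 0))).
  rewrite /kappa normrM normfV [ `|ell`!%:R|]ger0_norm// !invfM invrK; ring.
apply: (bandwidth_asymptotics l0 dL C0 c0 g0 kap0 H1 H2 H3 Bg vg gx0 Hr
  (Fn := fun n => empirical_cdf (fun i => X i w) n)
  (Fh := fun n => smoothed_cdf K (fun i => X i w) n (h n w))).
apply: filterS2 hw uw => n [hn dn] un; split => // x.
by rewrite smoothed_cdfE//; exact: smoothing_diff_le.
Qed.
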